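(* Let $1 < p_1 \le p_2 \le \dots \to \infty$ be the sequence of generalized primes of a (discrete) Beurling number system, with prime counting function $\pi(x)$ and integer counting function $N(x)$. Suppose that the system satisfies the Chebyshev upper bound $\pi(x) \ll x/\log x$ and that its integers have a positive density, i.e. there is a constant $a > 0$ such that $N(x) \sim ax$ as $x \to \infty$. Then, for every integer $K \ge 2$ and every integer $c$ with $0 \le c < K$, $$ S_{K,c}(x) \sim \frac{ax}{K} \qquad (x \to \infty), $$ where $S_{K,c}(x)$ is the number of generalized integers of the system not exceeding $x$ whose number of prime factors (counted with multiplicity) is congruent to $c$ modulo $K$.
   Context: A (discrete) Beurling generalized prime number system is a sequence of real numbers $1 < p_1 \le p_2 \le \dots \to \infty$, called generalized primes (repetitions are allowed). The generalized integers of the system are the elements of the multiplicative semigroup generated by the generalized primes and $1$. They are counted with multiplicity: a generalized integer is a formal finite product $n = \prod_j p_j^{\nu_j}$ with integer exponents $\nu_j \ge 0$, almost all zero (the empty product being $1$), and different exponent sequences $(\nu_j)_j$ give different generalized integers even if the real values coincide. The number of prime factors of $n = \prod_j p_j^{\nu_j}$ is $\sum_j \nu_j$ (prime factors counted with multiplicity). The counting functions are $\pi(x) = \#\{j : p_j \le x\}$ and $N(x) = \#\{n : n \le x\}$, the latter counting generalized integers with multiplicity, i.e. different exponent sequences $(\nu_j)_j$ are counted separately even if the real values $\prod_j p_j^{\nu_j}$ coincide; $S_{K,c}(x)$ likewise counts generalized integers $n \le x$ with multiplicity. The notation $\pi(x) \ll x/\log x$ means that there is a constant $C$ with $\pi(x)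 \le C x/\log x$ for all sufficiently large $x$. *)

(* Defs.v *)
From mathcomp Require Import all_boot all_order all_algebra finmap.
From mathcomp Require Import all_classical all_reals all_analysis.

Set Implicit Arguments.
Unset Strict Implicit.
Unset Printing Implicit Defensive.

Import Order.TTheory GRing.Theory Num.Theory.
Import numFieldNormedType.Exports.

Local Open Scope classical_set_scope.
Local Open Scope ring_scope.

(* Lets the Landau notations be used at [+oo]. *)
Canonical pinfty_filter_on (R : numFieldType) : filter_on R :=
  FilterType (pinfty_nbhs R) _.

Definition beurling_system (R : realType) (p : nat -> R) : Prop :=
  [/\ 1 < p 0%N, nondecreasing_seq p & p n @[n --> \oo] --> +oo].

(* A generalized integer is its exponent sequence, so that products with equal
   real values but different exponents are counted separately. *)
Definition gint : Type := {fsfun nat -> nat with 0%N}.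

Definition gint_value (R : realType) (p : nat -> R) (nu : gint) : R :=
  \prod_(j <- finsupp nu) p j ^+ nu j.

Definition num_prime_factors (nu : gint) : nat :=
  (\sum_(j <- finsupp nu) nu j)%N.

(* [fset_set] is only meaningful on finite sets; the three counted sets below
   are finite for every Beurling system, see [finite_gprimes_le] and
   [finite_gints_le]. *)
Definition prime_count (R : realType) (p : nat -> R) (x : R) : nat :=
  #|` fset_set [set j | p j <= x] |.

Definition integer_count (R : realType) (p : nat -> R) (x : R) : nat :=
  #|` fset_set [set nu : gint | gint_value p nu <= x] |.

Definition residue_count (R : realType) (p : nat -> R) (K c : nat) (x : R) :
    nat :=
  #|` fset_set [set nu : gint | gint_value p nu <= x /\
                                num_prime_factors nu = c %[mod K] ] |.

Definition chebyshev_upper (R : realType) (p : nat -> R) : Prop :=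
  exists C : R, \forall x \near +oo, (prime_count p x)%:R <= C * (x / ln x).

Lemma finite_gprimes_le (R : realType) (p : nat -> R) (x : R) :
  beurling_system p -> finite_set [set j | p j <= x].
Proof.
move=> [_ pnd poo].
have [m _ hm] : \forall n \near \oo, x < p n by move/cvgryPgt : poo; apply.
apply: (@sub_finite_set _ _ `I_m); last exact: finite_II.
move=> j /= pjx; rewrite ltnNge; apply/negP => mj.
by move: (hm _ mj) => /=; rewrite ltNge pjx.
Qed.

Lemma finite_gints_le (R : realType) (p : nat -> R) (x : R) :
  beurling_system p -> finite_set [set nu : gint | gint_value p nu <= x].
Proof.
move=> bp; have [p01 pnd poo] := bp.
have p1 j : 1 < p j by rewrite (lt_le_trans p01)// pnd.
have pX1 j k : 1 <= p j ^+ k by rewrite exprn_ege1// ltW.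
have [m _ hm] : \forall n \near \oo, x < p n by move/cvgryPgt : poo; apply.
have [M hM] : exists M, x < p 0%N ^+ M.
  have d0 : 0 < p 0%N - 1 by rewrite subr_gt0.
  exists (Num.bound `|x / (p 0%N - 1)|).
  have xb : x < (p 0%N - 1) *+ Num.bound `|x / (p 0%N - 1)|.
    rewrite -mulr_natl -ltr_pdivrMr//.
    by rewrite (le_lt_trans (ler_norm _))// archi_boundP// normr_ge0.
  apply: (lt_le_trans xb).
  elim: (Num.bound _) => [|k IH]; first by rewrite mulr0n expr0.
  rewrite mulrS exprS -[X in X * _](subrK 1) mulrDl mul1r lerD//.
  by apply: ler_peMr; rewrite ?pX1 ?ltW.
have fac (nu : gint) j : p j ^+ nu j <= gint_value p nu.
  have ge1 (P : pred nat) : 1 <= \prod_(i <- finsupp nu | P i) p i ^+ nu i.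
    by elim/big_rec: _ => // i y _ y1; rewrite mulr_ege1.
  have [jn|jn] := boolP (j \in finsupp nu); last first.
    by rewrite fsfun_dflt// expr0; exact: ge1.
  rewrite /gint_value (bigD1_seq j) ?fset_uniq//=.
  by apply: ler_peMr; rewrite ?ge1// (le_trans ler01).
pose F (f : {ffun 'I_m -> 'I_M}) : gint :=
  [fsfun j in [fset i in iota 0 m]%fset =>
     if insub (j : nat) is Some i then nat_of_ord (f i) else 0%N].
apply: (@sub_finite_set _ _ (F @` setT)); last exact: finite_image.
move=> nu /= nux.
have nM j : (nu j < M)%N.
  rewrite ltnNge; apply/negP => Mn.
  have := le_trans (fac nu j) nux; rewrite leNgt => /negP; apply.
  apply: (lt_le_trans hM); apply: (@le_trans _ _ (p 0%N ^+ nu j)).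
    by rewrite ler_weXn2l// ltW.
  by rewrite lerXn2r ?pnd// nnegrE ltW// (lt_trans ltr01).
have nm j : (m <= j)%N -> nu j = 0%N.
  move=> mj; apply/eqP; rewrite -leqn0 leqNgt; apply/negP => nj.
  have := le_trans (fac nu j) nux; rewrite leNgt => /negP; apply.
  by apply: (lt_le_trans (hm _ mj)); rewrite ler_eXnr// ltW.
exists [ffun i : 'I_m => Ordinal (nM i)] => //.
apply/fsfunP => j; rewrite /F fsfunE.
case: ifPn => [|]; rewrite !inE /= mem_iota add0n /= => jm.
  by case: insubP => [i _ ij|]; [rewrite ffunE /= ij|rewrite jm].
by rewrite nm// leqNgt.
Qed.

(* Main.v *)
Require Import Defs.
From mathcomp Require Import all_boot all_order all_algebra.
From mathcomp Require Import all_classical all_reals all_analysis.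
From mathcomp Require Import finmap complex cyclic separable cyclotomic zify ring lra.
Set Implicit Arguments.
Unset Strict Implicit.
Unset Printing Implicit Defensive.
Import Order.TTheory GRing.Theory Num.Theory.
Import numFieldNormedType.Exports.
Local Open Scope classical_set_scope.
Local Open Scope ring_scope.

(** Write Omega for the number of prime factors and fix a primitive K-th root
of unity w.  Orthogonality of the powers of w expresses K times the counting
function of a residue class as the sum over m < K of w^(-mc) times the sum of
(w^m)^Omega over the integers up to x.  The term m = 0 is N(x), so everything
rests on [mean_vanishes]: if z^K = 1 and z <> 1, the mean value of z^Omega
tends to zero.  This is a case of Halasz's theorem, and the argument is
elementary: it uses no Dirichlet series.

Suppose that the mean does not vanish.  Let N_k and M_k be the number of
integers n <= x free of the first k primes and the sum of z^Omega over them,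
and let s > 0 be the smallest number such that every ratio |M_k| / N_k has
limit superior at most s.  Choose k for which s is nearly attained at
arbitrarily large x.  Splitting off from n its factor d composed of the primes
p_k, ..., p_(l-1) gives M_k(x) = sum_d z^Omega(d) M_l(x/d) and
N_k(x) = sum_d N_l(x/d).  As no term can exceed s N_l(x/d) by much, near
equality for the total forces near equality in most terms:
z^Omega(d) M_l(x/d) / N_l(x/d) lies close to one fixed complex number of
modulus s.  Since N_l(y) is asymptotically linear, the ratio M_l / N_l hardly
changes when y is multiplied by a constant close to 1, and z^Omega takes only
finitely many values.  Hence z^Omega takes the same value at most integers of
a short logarithmic window ([locally_constant_residue]).  To apply this to the
integers d <= Y, where l is the number of primes up to Y, their total weight
sum 1/d must be a positive proportion of the Euler product over the primes
p_k, ..., p_(l-1); that is the lower bound of Mertens type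
[rough_density_lower], a consequence of the Chebyshev bound.

Now colour the logarithmic windows of the integers up to Y by the value that
z^Omega takes on their typical elements.  Adjacent windows nearly always have
the same colour, and multiplication by a prime in the b-th window shows that,
for most primes, moving by b windows multiplies nearly all colours by z.  The
Chebyshev bound prevents primes from concentrating in few windows, so such
shifts b form a positive proportion of all windows.  Consider the number r(i)
of windows whose colour changes under the shift by i.  It moves by small steps,
and if it ever became large there would be indices i_1, ..., i_n with well
separated values of r; the translates of the set of good shifts by these
indices would be disjoint, which is impossible for want of room.  So r is small
everywhere, in particular at a good shift, where the colour is both unchanged
and multiplied by z at some window ([almost_period_fixpoint]).  As colours are
nonzero, z = 1, a contradiction. *)

(** * Colourings almost equivariant under many shifts *)

Section AlmostPeriods.
Variables (T : eqType) (chi : nat -> T) (sigma : T -> T).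

Definition shift_dist (I i j : nat) : nat :=
  count (fun u => chi (u + i)%N != chi (u + j)%N) (iota 0 I).

Definition shift_defect (I b : nat) : nat :=
  count (fun u => chi (u + b)%N != sigma (chi u)) (iota 0 I).

Lemma shift_dist_tri (I i j k : nat) :
  (shift_dist I i k <= shift_dist I i j + shift_dist I j k)%N.
Proof.
rewrite /shift_dist -count_predUI.
apply: leq_trans (leq_addr _ _); apply: sub_count => u /=.
by case: (chi (u + i)%N =P chi (u + j)%N) => [->|].
Qed.

Lemma shift_distC (I i j : nat) : shift_dist I i j = shift_dist I j i.
Proof. by apply: eq_count => u; rewrite eq_sym. Qed.

Lemma count_shift (P : pred nat) (i I J : nat) : (i + I <= J)%N ->
  (count (fun u => P (u + i)%N) (iota 0 I) <= count P (iota 0 J))%N.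
Proof.
move=> iIJ.
have -> : count (fun u => P (u + i)%N) (iota 0 I) = count P (iota i I).
  rewrite -[in RHS](addn0 i) iotaDl count_map.
  by apply: eq_count => u /=; rewrite addnC.
rewrite -(subnKC iIJ) iotaD iotaD add0n !count_cat; lia.
Qed.

Lemma shift_dist_succ (I i : nat) : (i <= I)%N ->
  (shift_dist I i i.+1 <= shift_dist (I + I) 0 1)%N.
Proof.
move=> iI; have := @count_shift (fun v => chi v != chi v.+1) i I (I + I).
rewrite /shift_dist => H.
under eq_count do rewrite addnS.
under [X in (_ <= X)%N]eq_count do rewrite addn0 addn1.
by apply: H; lia.
Qed.

Hypothesis sigma_inj : injective sigma.

(** If i + b = j + b', the colours at u + i and u + j are both carried by
[sigma] to the colour at u + i + b, apart from the defects of b and b'; this is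
where the injectivity of [sigma] enters. *)
Lemma shift_dist_defect (I E i j b b' : nat) : (i <= I)%N -> (j <= I)%N ->
  (i + b = j + b')%N ->
  (shift_defect (I + I) b <= E)%N -> (shift_defect (I + I) b' <= E)%N ->
  (shift_dist I i j <= E + E)%N.
Proof.
move=> iI jI e Eb Eb'.
have Hb := @count_shift (fun v => chi (v + b)%N != sigma (chi v)) i I (I + I).
have Hb' := @count_shift (fun v => chi (v + b')%N != sigma (chi v)) j I (I + I).
apply: leq_trans (leq_add (leq_trans (Hb _) Eb) (leq_trans (Hb' _) Eb')); try lia.
rewrite -count_predUI; apply: leq_trans (leq_addr _ _).
apply: sub_count => u /= nij; apply: contraNT nij; rewrite negb_or !negbK.
move=> /andP[/eqP h1 /eqP h2]; apply/eqP/sigma_inj; rewrite -h1 -h2.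
by congr (chi _); lia.
Qed.

(** Were [shift_dist I 0] ever to reach the height 5En, its small increments
would make it pass close to each of the heights 5Ej.  At the first passages two
indices differ in [shift_dist I 0] by more than 2E, so by
[shift_dist_defect] the translates of [B] by these n + 1 indices are disjoint;
but they all lie in an interval of length 2I. *)
Lemma shift_dist_bounded (I E n : nat) (B : seq nat) :
  (0 < E)%N -> uniq B -> {in B, forall b, (b < I)%N} ->
  (shift_dist (I + I) 0 1 <= E)%N ->
  {in B, forall b, (shift_defect (I + I) b <= E)%N} ->
  (I + I < n * size B)%N ->
  forall i, (i < I)%N -> (shift_dist I 0 i < 5 * E * n)%N.
Proof.
move=> E0 uB BI trans defect cardB i iI; rewrite ltnNge; apply/negP => big.
have ex (j : nat) : (j <= n)%N -> exists v, (5 * E * j <= shift_dist I 0 v)%N.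
  move=> jn; exists i; apply: leq_trans big; nia.
(* the first passage of [shift_dist I 0] at the height 5Ej *)
pose lv (j : 'I_n.+1) : nat := ex_minn (ex j (ltn_ord j)).
have lvi j : (lv j <= i)%N.
  rewrite /lv; case: ex_minnP => m _; apply; apply: leq_trans big.
  by rewrite leq_mul2l -ltnS ltn_ord orbT.
have lv1 (j : 'I_n.+1) : (5 * E * j <= shift_dist I 0 (lv j))%N.
  by rewrite /lv; case: ex_minnP.
have lv2 (j : 'I_n.+1) : (shift_dist I 0 (lv j) <= 5 * E * j + E)%N.
  have := lvi j; rewrite /lv; case: ex_minnP => -[|m] _ mmin mi.
    by rewrite /shift_dist (eq_count (a2 := pred0)) ?count_pred0// => u; rewrite eqxx.
  apply: leq_trans (shift_dist_tri I 0 m m.+1) _; apply: leq_add; last first.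
    by apply: leq_trans trans; apply: shift_dist_succ; lia.
  by apply: ltnW; rewrite ltnNge; apply/negP => /mmin; rewrite ltnn.
pose s := [seq (lv j + b)%N | j <- enum 'I_n.+1, b <- B].
have us : uniq s.
  apply: allpairs_uniq; rewrite ?enum_uniq// => -[j b] [j' b'] /=.
  move=> /allpairsP[[j1 b1] /= [_ b1B [-> ->]]] /allpairsP[[j2 b2] /= [_ b2B [-> ->]]] e.
  have near : (shift_dist I (lv j1) (lv j2) <= E + E)%N.
    apply: (shift_dist_defect _ _ e); try exact: defect.
      by have := lvi j1; lia.
    by have := lvi j2; lia.
  have near' : (shift_dist I (lv j2) (lv j1) <= E + E)%N by rewrite shift_distC.
  have t1 := shift_dist_tri I 0 (lv j1) (lv j2).
  have t2 := shift_dist_tri I 0 (lv j2) (lv j1).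
  have := lv1 j1; have := lv1 j2; have := lv2 j1; have := lv2 j2.
  move=> a1 a2 a3 a4.
  have ejn : j1 = j2 :> nat by nia.
  have ej : j1 = j2 by exact: val_inj.
  by subst j2; congr pair; apply/eqP; rewrite -(eqn_add2l (lv j1)) e.
have sI : {subset s <= iota 0 (I + I)}.
  move=> v /allpairsP[[j b] /= [_ bB ->]]; rewrite mem_iota.
  by have := lvi j; have := BI b bB; lia.
have := uniq_leq_size us sI.
by rewrite size_iota size_allpairs size_enum_ord; nia.
Qed.

(** For b in [B] the colour at most points u is unchanged by the shift by b and
is also multiplied by it through [sigma]. *)
Lemma almost_period_fixpoint (I E n : nat) (B : seq nat) :
  (0 < E)%N -> uniq B -> {in B, forall b, (b < I)%N} ->
  (shift_dist (I + I) 0 1 <= E)%N ->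
  {in B, forall b, (shift_defect (I + I) b <= E)%N} ->
  (I + I < n * size B)%N -> (5 * E * n + E <= I)%N ->
  exists u, sigma (chi u) = chi u.
Proof.
move=> E0 uB BI trans defect cardB EI.
have [b bB] : exists b, b \in B.
  case: B cardB {uB BI defect} => [|b B]; last by exists b; rewrite mem_head.
  by rewrite muln0.
have d1 := shift_dist_bounded E0 uB BI trans defect cardB (BI b bB).
have d2 : (shift_defect I b <= E)%N.
  apply: leq_trans (defect b bB); rewrite /shift_defect iotaD count_cat; lia.
have /hasP[u _ /andP[/negPn/eqP h1 /negPn/eqP h2]] :
    has (fun u => ~~ (chi (u + 0)%N != chi (u + b)%N) &&
                  ~~ (chi (u + b)%N != sigma (chi u))) (iota 0 I).
  rewrite -[has _ _]negbK -all_predC; apply/negP => /allP allc.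
  have : (I <= shift_dist I 0 b + shift_defect I b)%N.
    rewrite /shift_dist /shift_defect -count_predUI.
    apply: leq_trans (leq_addr _ _); rewrite -[X in (X <= _)%N](size_iota 0 I).
    rewrite leq_eqVlt eq_sym -all_count; apply/orP; left; apply/allP => u uI /=; have := allc u uI => /=.
    by rewrite negb_and !negbK.
  by lia.
by exists u; rewrite -h2 -h1 addn0.
Qed.

End AlmostPeriods.


(** * Exponent vectors and their values *)
Definition gmul (g h : gint) : gint :=
  [fsfun j in (finsupp g `|` finsupp h)%fset => (g j + h j)%N].

Definition gdiv (n g : gint) : gint := [fsfun j in finsupp n => (n j - g j)%N].

Definition gprime (i : nat) : gint := [fsfun j in [fset i]%fset => 1%N].

Definition gbelow (l : nat) (n : gint) : gint :=
  [fsfun j in finsupp n => if (j < l)%N then n j else 0%N].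

(** Divisibility of formal products, not of their real values. *)
Definition gdvd (g n : gint) : bool := all (fun j => (g j <= n j)%N) (finsupp g).

Definition gfree (k : nat) (n : gint) : bool := all (fun j => n j == 0%N) (iota 0 k).

Definition gsmooth (l : nat) (n : gint) : bool := all (fun j => (j < l)%N) (finsupp n).

Section ExponentVectors.
Implicit Types (g h n d : gint).

Lemma gmulE g h j : gmul g h j = (g j + h j)%N.
Proof.
rewrite fsfunE !inE; case: ifPn => //; rewrite negb_or => /andP[].
by move=> /fsfun_dflt -> /fsfun_dflt ->.
Qed.

Lemma gdivE n g j : gdiv n g j = (n j - g j)%N.
Proof. by rewrite fsfunE; case: ifPn => // /fsfun_dflt ->; rewrite sub0n. Qed.

Lemma gprimeE i j : gprime i j = (j == i).
Proof. by rewrite fsfunE !inE; case: eqP. Qed.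

Lemma gbelowE l n j : gbelow l n j = if (j < l)%N then n j else 0%N.
Proof. by rewrite fsfunE; case: ifPn => // /fsfun_dflt ->; case: ifP. Qed.

Lemma gdvdP g n : reflect (forall j, (g j <= n j)%N) (gdvd g n).
Proof.
apply: (iffP allP) => [H j|H j _]; last exact: H.
by have [/H//|/fsfun_dflt ->] := boolP (j \in finsupp g).
Qed.

Lemma gfreeP k n : reflect (forall j, (j < k)%N -> n j = 0%N) (gfree k n).
Proof.
apply: (iffP allP) => [H j jk|H j]; first by apply/eqP/H; rewrite mem_iota.
by rewrite mem_iota add0n => /H ->.
Qed.

Lemma gsmoothP l n : reflect (forall j, (l <= j)%N -> n j = 0%N) (gsmooth l n).
Proof.
apply: (iffP allP) => [H j jl|H j]; last first.
  by rewrite mem_finsupp ltnNge; apply: contraNN => /H ->.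
by apply/eqP; rewrite -[_ == _]negbK -mem_finsupp; apply/negP => /H; rewrite ltnNge jl.
Qed.

Lemma gmulK g : cancel (gmul g) (gdiv^~ g).
Proof. by move=> n; apply/fsfunP => j; rewrite gdivE gmulE addKn. Qed.

Lemma gmul_inj g : injective (gmul g).
Proof. exact: can_inj (gmulK g). Qed.

Lemma gdivK g n : gdvd g n -> gmul g (gdiv n g) = n.
Proof. by move=> /gdvdP H; apply/fsfunP => j; rewrite gmulE gdivE subnKC. Qed.

Lemma gdvd_mulr g n : gdvd g (gmul g n).
Proof. by apply/gdvdP => j; rewrite gmulE leq_addr. Qed.

Lemma gprime_dvd i n : gdvd (gprime i) n = (0 < n i)%N.
Proof.
apply/gdvdP/idP => [/(_ i)|ni j]; rewrite gprimeE ?eqxx//.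
by case: eqP => [->|].
Qed.

Lemma gfree_mul k g n : gfree k (gmul g n) = gfree k g && gfree k n.
Proof.
apply/gfreeP/andP => [H|[/gfreeP Hg /gfreeP Hn] j jk].
  by split; apply/gfreeP => j /H; rewrite gmulE; lia.
by rewrite gmulE Hg// Hn.
Qed.

Lemma gfree_prime k i : gfree k (gprime i) = (k <= i)%N.
Proof.
apply/gfreeP/idP => [H|ki j jk]; last by rewrite gprimeE; lia.
by rewrite leqNgt; apply/negP => /H; rewrite gprimeE eqxx.
Qed.

Lemma gfreeS k n : gfree k.+1 n = gfree k n && (n k == 0%N).
Proof. by rewrite /gfree -addn1 iotaD all_cat /= add0n andbT. Qed.

Lemma gfreeW k l n : (k <= l)%N -> gfree l n -> gfree k n.
Proof. by move=> kl /gfreeP H; apply/gfreeP => j jk; apply: H; lia. Qed.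

Lemma gbelow_smooth l n : gsmooth l (gbelow l n).
Proof. by apply/gsmoothP => j jl; rewrite gbelowE ltnNge jl. Qed.

Lemma gbelow_id l n : gsmooth l n -> gbelow l n = n.
Proof.
by move=> /gsmoothP H; apply/fsfunP => j; rewrite gbelowE; case: ltnP => // /H.
Qed.

Lemma gbelow_dvd l n : gdvd (gbelow l n) n.
Proof. by apply/gdvdP => j; rewrite gbelowE; case: ifP. Qed.

Lemma gfree_below k l n : (k <= l)%N -> gfree k (gbelow l n) = gfree k n.
Proof.
move=> kl; apply/gfreeP/gfreeP => H j jk; have := H j jk; rewrite gbelowE ifT//; lia.
Qed.

Lemma gbelow_mul l d m : gsmooth l d -> (gbelow l (gmul d m) == d) = gfree l m.
Proof.
move=> /gsmoothP sd; apply/eqP/gfreeP => [H j jl|H].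
  by have := congr1 (fun f : gint => f j) H; rewrite gbelowE jl gmulE; lia.
apply/fsfunP => j; rewrite gbelowE gmulE; case: ltnP => [/H ->|/sd ->//].
by rewrite addn0.
Qed.

Lemma gsupp_bound (n : gint) : exists m, gsmooth m n.
Proof.
exists (\max_(j <- finsupp n) j).+1; apply/gsmoothP => j jm.
apply/eqP; rewrite -[_ == _]negbK -mem_finsupp; apply/negP => jn.
suff : (j <= \max_(i <- finsupp n) i)%N by lia.
by apply: (@leq_bigmax_seq _ _ xpredT id).
Qed.

Lemma gsmoothW l m n : (l <= m)%N -> gsmooth l n -> gsmooth m n.
Proof. by move=> lm /gsmoothP H; apply/gsmoothP => j jm; apply: H; lia. Qed.

Lemma gsupp_bound2 (n1 n2 : gint) : exists m, gsmooth m n1 /\ gsmooth m n2.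
Proof.
have [m1 H1] := gsupp_bound n1; have [m2 H2] := gsupp_bound n2.
by exists (maxn m1 m2); split; [move: H1|move: H2]; apply: gsmoothW; lia.
Qed.

Lemma gsmooth_mul m g n : gsmooth m g -> gsmooth m n -> gsmooth m (gmul g n).
Proof. by move=> /gsmoothP H /gsmoothP H'; apply/gsmoothP => j jm; rewrite gmulE H// H'. Qed.

Lemma big_smooth (S : Type) (idx : S) (op : Monoid.com_law idx) (F : nat -> nat -> S)
    (n : gint) (m : nat) : gsmooth m n -> (forall j, F j 0%N = idx) ->
  \big[op/idx]_(j <- finsupp n) F j (n j) = \big[op/idx]_(j < m) F j (n j).
Proof.
move=> /allP sm F0; rewrite -(big_mkord xpredT (fun j => F j (n j))).
rewrite [RHS](bigID (mem (finsupp n))) /= [X in op _ X]big1 ?Monoid.mulm1; last first.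
  by move=> j /fsfun_dflt ->.
rewrite -[RHS]big_filter; apply: perm_big; apply: uniq_perm.
- exact: fset_uniq.
- by rewrite filter_uniq// iota_uniq.
move=> j; rewrite mem_filter mem_index_iota /=.
by case: (boolP (j \in _)) => //= /sm ->.
Qed.

Lemma num_prime_factorsE n m : gsmooth m n ->
  num_prime_factors n = (\sum_(j < m) n j)%N.
Proof. by move=> sm; rewrite /num_prime_factors (big_smooth (F := fun _ e => e) _ sm). Qed.

Lemma num_prime_factors_mul g n :
  num_prime_factors (gmul g n) = (num_prime_factors g + num_prime_factors n)%N.
Proof.
have [m [s1 s2]] := gsupp_bound2 g n.
rewrite (num_prime_factorsE (gsmooth_mul s1 s2)) (num_prime_factorsE s1).
rewrite (num_prime_factorsE s2) -big_split /=.
by apply: eq_bigr => j _; rewrite gmulE.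
Qed.

Lemma gsmooth_prime i : gsmooth i.+1 (gprime i).
Proof. by apply/gsmoothP => j; rewrite gprimeE; lia. Qed.

Lemma num_prime_factors_prime i : num_prime_factors (gprime i) = 1%N.
Proof.
rewrite (num_prime_factorsE (gsmooth_prime i)) big_ord_recr /= gprimeE eqxx.
by rewrite big1// => j _; rewrite gprimeE; have := ltn_ord j; lia.
Qed.

End ExponentVectors.

Section Values.
Variables (R : realType) (p : nat -> R).
Implicit Types (g n : gint).
Local Notation val := (gint_value p).

Lemma gvalE n m : gsmooth m n -> val n = \prod_(j < m) p j ^+ n j.
Proof.
by move=> sm; rewrite /gint_value (big_smooth (F := fun j e => p j ^+ e) _ sm).
Qed.

Lemma gval_mul g n : val (gmul g n) = val g * val n.
Proof.
have [m [s1 s2]] := gsupp_bound2 g n.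
rewrite (gvalE (gsmooth_mul s1 s2)) (gvalE s1) (gvalE s2) -big_split /=.
by apply: eq_bigr => j _; rewrite gmulE exprD.
Qed.

Lemma gval_prime i : val (gprime i) = p i.
Proof.
rewrite (gvalE (gsmooth_prime i)) big_ord_recr /= gprimeE eqxx expr1.
by rewrite big1 ?mul1r// => j _; rewrite gprimeE ltn_eqF// expr0.
Qed.

Hypothesis hp : beurling_system p.

Lemma gprime_gt1 j : 1 < p j.
Proof. by case: hp => p0 pnd _; apply: lt_le_trans p0 (pnd _ _ _). Qed.

Lemma gprime_gt0 j : 0 < p j.
Proof. exact: lt_trans ltr01 (gprime_gt1 j). Qed.

Lemma gprime_nondecreasing i j : (i <= j)%N -> p i <= p j.
Proof. by case: hp => _ + _; apply. Qed.

Lemma ln_gprime_gt0 j : 0 < ln (p j).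
Proof. by rewrite ln_gt0 ?gprime_gt1. Qed.

Lemma gval_ge1 n : 1 <= val n.
Proof.
rewrite /gint_value; elim/big_rec: _ => // i y _ y1.
by rewrite mulr_ege1// exprn_ege1// ltW// gprime_gt1.
Qed.

Lemma gval_gt0 n : 0 < val n.
Proof. exact: lt_le_trans ltr01 (gval_ge1 n). Qed.

Lemma gval_dvd g n : gdvd g n -> val g <= val n.
Proof.
move=> /gdivK <-; rewrite gval_mul ler_peMr ?gval_ge1// ltW ?gval_gt0//.
Qed.

Lemma ln_gval n m : gsmooth m n -> ln (val n) = \sum_(j < m) (n j)%:R * ln (p j).
Proof.
move=> sm; rewrite (gvalE sm).
have H : 0 < \prod_(j < m) p j ^+ n j /\
    ln (\prod_(j < m) p j ^+ n j) = \sum_(j < m) (n j)%:R * ln (p j).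
  elim/big_rec2: _ => [|j y x _ [x0 <-]]; first by rewrite ln1; split.
  have pj0 : 0 < p j ^+ n j by rewrite exprn_gt0 ?gprime_gt0.
  by rewrite mulr_gt0// lnM ?posrE// lnXn ?gprime_gt0// mulr_natl.
by case: H.
Qed.

Lemma gprime_le_gval n j : (0 < n j)%N -> p j <= val n.
Proof. by rewrite -gprime_dvd => /gval_dvd; rewrite gval_prime. Qed.

Definition upto (x : R) : {fset gint} := fset_set [set n : gint | val n <= x].

Lemma in_upto x n : (n \in upto x) = (val n <= x).
Proof.
rewrite in_fset_set; last exact: finite_gints_le.
by apply/idP/idP => [/set_mem|h]; last exact/mem_set.
Qed.

(** Multiplication by g is a bijection from the integers up to x / g onto the
multiples of g up to x, whatever the coincidences between real values. *)
Lemma big_upto_dvd (S : nmodType) (P : pred gint) (F : gint -> S) (g : gint) (x : R) :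
  \sum_(n <- upto x | gdvd g n && P n) F n =
  \sum_(m <- upto (x / val g) | P (gmul g m)) F (gmul g m).
Proof.
rewrite -(big_map (gmul g) P F) -[LHS]big_filter -[RHS]big_filter.
apply: perm_big; apply: uniq_perm; rewrite ?filter_uniq ?fset_uniq//.
  by rewrite map_inj_uniq ?fset_uniq//; exact: gmul_inj.
move=> n; rewrite !mem_filter [gdvd g n && _]andbC -andbA.
congr (_ && _); apply/andP/mapP => [[gn nx]|[m mx ->]].
  exists (gdiv n g); last by rewrite gdivK.
  rewrite in_upto ler_pdivlMr ?gval_gt0// mulrC -gval_mul gdivK//.
  by rewrite -in_upto.
by rewrite in_upto gdvd_mulr gval_mul mulrC -ler_pdivlMr ?gval_gt0// -in_upto.
Qed.

(** Unique factorization n = d m, where d collects the primes of index below l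
and m the others. *)
Lemma big_upto_below (S : nmodType) (k l : nat) (F : gint -> S) (x : R) :
  (k <= l)%N ->
  \sum_(n <- upto x | gfree k n) F n =
  \sum_(d <- upto x | gsmooth l d && gfree k d)
    \sum_(m <- upto (x / val d) | gfree l m) F (gmul d m).
Proof.
move=> kl.
transitivity (\sum_(d <- upto x | gsmooth l d && gfree k d)
    \sum_(n <- upto x | gbelow l n == d) F n).
  rewrite (exchange_big_dep (gfree k)) /=; last first.
    by move=> d n /andP[_ fd] /eqP dE; rewrite -(gfree_below _ kl) dE.
  rewrite big_seq_cond [RHS]big_seq_cond; apply: eq_bigr => n /andP[nx fn].
  rewrite -big_filter (perm_big [:: gbelow l n]) ?big_seq1//.
  apply: uniq_perm; rewrite ?filter_uniq ?fset_uniq// => d.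
  rewrite mem_filter inE; apply/idP/eqP => [/andP[/andP[_ /eqP ->//]]|->].
  rewrite gbelow_smooth gfree_below// fn eqxx in_upto /=.
  by apply: le_trans (gval_dvd (gbelow_dvd l n)) _; rewrite -in_upto.
apply: eq_bigr => d /andP[sd _].
under [RHS]eq_bigl do rewrite -(gbelow_mul _ sd).
rewrite -(big_upto_dvd (fun n => gbelow l n == d) F); apply: eq_bigl => n.
by case: eqP => [<-|]; rewrite ?andbF// andbT gbelow_dvd.
Qed.

End Values.


(** * Neighbourhoods of infinity *)
Section NearInfinity.
Variable R : realType.
Implicit Types P : R -> Prop.

Lemma near_pinftyP P :
  (\forall x \near +oo, P x) <-> exists2 X, 1 <= X & forall x, X <= x -> P x.
Proof.
split=> [[M [_ HM]]|[X _ HX]].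
  exists (Num.max 1 (M + 1)) => [|x]; first by rewrite le_max lexx.
  by rewrite ge_max => /andP[_ Mx]; apply: HM; apply: lt_le_trans Mx; rewrite ltrDl.
by exists X; split; [exact: num_real|move=> x /ltW/HX].
Qed.

Lemma near_pinfty_div P c : 0 < c ->
  (\forall x \near +oo, P x) -> \forall x \near +oo, P (x / c).
Proof.
move=> c0 /near_pinftyP[X X1 HX]; apply/near_pinftyP.
exists (Num.max 1 (X * c)) => [|x]; first by rewrite le_max lexx.
by rewrite ge_max => /andP[_ Xx]; apply: HX; rewrite ler_pdivlMr.
Qed.

Lemma near_pinfty_ln P :
  (\forall x \near +oo, P x) -> \forall x \near +oo, P (ln x).
Proof.
move=> /near_pinftyP[X X1 HX]; apply/near_pinftyP; exists (expR X).
  by rewrite -expR0 ler_expR; lra.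
move=> x Xx; apply: HX; rewrite -[X]expRK ler_ln ?posrE ?expR_gt0//.
exact: lt_le_trans (expR_gt0 X) Xx.
Qed.

End NearInfinity.

(** * Integers free of the first k primes *)
Section Counting.
Variables (R : realType) (p : nat -> R).
Hypothesis hp : beurling_system p.
Local Notation val := (gint_value p).
Local Notation upto := (upto p).

Lemma big_upto_split (S : nmodType) (P : pred gint) (F : gint -> S) (x y : R) :
  x <= y ->
  \sum_(n <- upto y | P n) F n =
  \sum_(n <- upto x | P n) F n + \sum_(n <- upto y | P n && (x < val n)) F n.
Proof.
move=> xy; rewrite (bigID (fun n => val n <= x)) /=; congr (_ + _); last first.
  by apply: eq_bigl => n; rewrite ltNge.
rewrite -[LHS]big_filter -[RHS]big_filter; apply: perm_big.
apply: uniq_perm; rewrite ?filter_uniq ?fset_uniq// => n.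
rewrite !mem_filter !in_upto//; case: (P n) => //=.
by case: (leP (val n) x) => //= nx; rewrite (le_trans nx xy).
Qed.

Lemma ler_sum_upto (P Q : pred gint) (F G : gint -> R) (x : R) :
  (forall n, val n <= x -> P n -> Q n /\ F n <= G n) ->
  (forall n, Q n -> 0 <= G n) ->
  \sum_(n <- upto x | P n) F n <= \sum_(n <- upto x | Q n) G n.
Proof.
move=> H G0; rewrite big_mkcond [leRHS]big_mkcond big_seq [leRHS]big_seq.
apply: ler_sum => n; rewrite in_upto// => nx.
case: ifPn => [Pn|_]; last by case: ifPn => // /G0.
by have [-> //] := H n nx Pn.
Qed.

Lemma ler_upto (P : pred gint) (F : gint -> R) (x y : R) : x <= y ->
  (forall n, P n -> 0 <= F n) ->
  \sum_(n <- upto x | P n) F n <= \sum_(n <- upto y | P n) F n.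
Proof.
move=> xy F0; rewrite (big_upto_split _ _ xy) lerDl.
by apply: sumr_ge0 => n /andP[/F0].
Qed.

Lemma upto_lt1 (x : R) : x < 1 -> upto x = fset0.
Proof.
move=> x1; apply/fsetP => n; rewrite in_upto// inE; apply/negbTE.
by rewrite -ltNge; apply: lt_le_trans x1 (gval_ge1 hp n).
Qed.

Definition rough_count (k : nat) (x : R) : R := \sum_(n <- upto x | gfree k n) 1.

Definition rough_density (k : nat) : R := \prod_(j < k) (1 - (p j)^-1).

Lemma rough_countE k x : rough_count k x = \sum_(n <- upto x | gfree k n) 1.
Proof. by []. Qed.

Lemma rough_density0 : rough_density 0 = 1.
Proof. by rewrite /rough_density big_ord0. Qed.

Lemma rough_density_gt0 k : 0 < rough_density k.
Proof.
apply: prodr_gt0 => j _; rewrite subr_gt0 invf_lt1 ?gprime_gt0//.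
exact: gprime_gt1.
Qed.

Lemma rough_count_ge0 k x : 0 <= rough_count k x.
Proof. by apply: sumr_ge0. Qed.

Lemma rough_count_le k x y : x <= y -> rough_count k x <= rough_count k y.
Proof. by move=> xy; apply: ler_upto. Qed.

Lemma rough_countW k l x : (k <= l)%N -> rough_count l x <= rough_count k x.
Proof.
by move=> kl; apply: ler_sum_upto => // n _ /(gfreeW kl).
Qed.

Lemma big_upto_gfreeS (S : zmodType) (F : gint -> S) k x :
  \sum_(n <- upto x | gfree k.+1 n) F n = \sum_(n <- upto x | gfree k n) F n -
    \sum_(m <- upto (x / p k) | gfree k m) F (gmul (gprime k) m).
Proof.
rewrite [X in X - _](bigID (fun n : gint => n k == 0%N)) /=.
rewrite -(gval_prime p k).
under [X in _ - X]eq_bigl => m.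
  rewrite -[gfree k m]andTb -(leqnn k) -(gfree_prime k k) -gfree_mul; over.
rewrite -(big_upto_dvd hp (gfree k) F (gprime k) x).
under eq_bigl do rewrite gfreeS.
rewrite -addrA [X in _ + X](_ : _ = 0) ?addr0//.
apply/eqP; rewrite subr_eq0; apply/eqP; apply: eq_bigl => n.
by rewrite gprime_dvd lt0n andbC.
Qed.

Lemma rough_countS k x :
  rough_count k.+1 x = rough_count k x - rough_count k (x / p k).
Proof. exact: big_upto_gfreeS. Qed.

Variable a : R.
Hypothesis ha : 0 < a.
Hypothesis density : forall e, 0 < e ->
  \forall x \near +oo, `|rough_count 0 x - a * x| <= e * x.

(** One step of the sieve: removing the multiples of p_k multiplies the density
by 1 - 1/p_k. *)
Lemma rough_count_asymp k e : 0 < e ->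
  \forall x \near +oo, `|rough_count k x - a * rough_density k * x| <= e * x.
Proof.
elim: k e => [|k IH] e e0.
  by rewrite /rough_density big_ord0 mulr1; exact: density.
have e2 : 0 < e / 2 by rewrite divr_gt0.
have pk0 := gprime_gt0 hp k; have pk1 := gprime_gt1 hp k.
have n1 := IH _ e2; have n2 := near_pinfty_div pk0 n1.
near=> x.
have x0 : 0 < x by near: x; apply: nbhs_pinfty_gt; exact: num_real.
have /= b1 : `|rough_count k x - a * rough_density k * x| <= e / 2 * x by near: x.
have /= b2 : `|rough_count k (x / p k) - a * rough_density k * (x / p k)|
   <= e / 2 * (x / p k) by near: x.
rewrite rough_countS /rough_density big_ord_recr /= -/(rough_density k).
rewrite [X in `|X|](_ : _ = (rough_count k x - a * rough_density k * x) -
  (rough_count k (x / p k) - a * rough_density k * (x / p k))); last by ring.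
apply: le_trans (ler_normB _ _) _; apply: le_trans (lerD b1 b2) _.
have : x / p k <= x by rewrite ler_pdivrMr// ler_peMr// ltW.
by move=> h; have := ler_wpM2l (ltW e2) h; lra.
Unshelve. all: end_near. Qed.

Lemma rough_count_near k c : 0 < c -> c < 1 -> \forall x \near +oo,
  (1 - c) * (a * rough_density k * x) <= rough_count k x <=
  (1 + c) * (a * rough_density k * x).
Proof.
move=> c0 c1; have aw0 : 0 < a * rough_density k by rewrite mulr_gt0 ?rough_density_gt0.
have e0 : 0 < c * (a * rough_density k) by rewrite mulr_gt0.
apply: filterS (rough_count_asymp k e0) => x; rewrite ler_norml => /andP[h1 h2].
by apply/andP; split; lra.
Qed.

(** For x < 1 there are no integers, and below the threshold of the asymptotic
the trivial bound by the count at the threshold costs only a constant, so the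
linear bound holds on the whole half-line. *)
Lemma integer_count_upper :
  exists2 C, 0 < C & forall k x, 0 <= x -> rough_count k x <= C * x.
Proof.
have /near_pinftyP[X X1 HX] := density ltr01.
exists ((a + 1) * X) => [|k x x0]; first by rewrite mulr_gt0 ?(lt_le_trans _ X1)// addr_gt0.
apply: le_trans (rough_countW _ (leq0n k)) _.
have a1 : 0 < a + 1 by rewrite addr_gt0.
have [x1|x1] := ltP x 1.
  rewrite /rough_count upto_lt1// big_seq_fset0 ?mulr_ge0 ?(le_trans _ X1)//; lra.
have main y : X <= y -> rough_count 0 y <= (a + 1) * y.
  by move=> /HX; rewrite ler_norml => /andP[_]; lra.
have [/main h|xX] := leP X x.
  apply: le_trans h _; rewrite -mulrA ler_wpM2l ?(ltW a1)// ler_peMl//.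
apply: le_trans (rough_count_le 0 (ltW xX)) _; apply: le_trans (main _ (lexx X)) _.
by rewrite ler_peMr// mulr_ge0 ?(ltW a1)//; lra.
Qed.

End Counting.


(** * Logarithmic growth by scaling *)
Section Growth.
Variable R : realType.

(** Induction along the sequence x, x/c, x/c^2, ..., which falls below 1. *)
Lemma scale_ind (c : R) (P : R -> Prop) : 1 < c ->
  (forall x, x < 1 -> P x) -> (forall x, 1 <= x -> P (x / c) -> P x) ->
  forall x, P x.
Proof.
move=> c1 P0 PS x; have c0 : 0 < c by apply: lt_trans c1.
have [/P0//|x1] := ltP x 1.
have [t xt] : exists t, x < c ^+ t.
  exists (Num.truncn (ln x / ln c)).+1.
  have x0 : 0 < x by apply: lt_le_trans x1.
  have lc : 0 < ln c by rewrite ln_gt0.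
  rewrite -ltr_ln ?posrE ?exprn_gt0// lnXn// -mulr_natl -ltr_pdivrMr//.
  by rewrite truncnS_gt.
elim: t x {x1} xt => [|t IH] x; first by rewrite expr0 => /P0.
move=> xt; have [/P0//|x1] := ltP x 1.
by apply: PS => //; apply: IH; rewrite ltr_pdivrMr// -exprSr.
Qed.

Lemma log_growth (F : R -> R) (C T : R) : 0 <= C ->
  (forall x, x < 1 -> F x <= T) ->
  (forall x, 1 <= x -> F x <= F (x / expR 1) + C) ->
  forall x, 1 <= x -> F x <= T + C * (ln x + 1).
Proof.
move=> C0 F0 FS.
suff H x : F x <= T + C * (if x < 1 then 0 else ln x + 1).
  by move=> x x1; have := H x; rewrite ltNge x1.
move: x; apply: (@scale_ind (expR 1)) => [|x x1|x x1 IH].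
- by rewrite -[ltLHS]expR0 ltr_expR.
- by rewrite x1 mulr0 addr0 F0.
have x0 : 0 < x by apply: lt_le_trans x1.
rewrite ltNge x1 /=; apply: le_trans (FS x x1) _.
have lx : 0 <= ln x by rewrite ln_ge0.
move: IH; case: ifP => _ IH; first by have := mulr_ge0 C0 lx; lra.
move: IH; rewrite ln_div ?posrE ?expR_gt0// expRK; lra.
Qed.

End Growth.

(** * Mertens sums of the generalized primes *)
Section Chebyshev.
Variables (R : realType) (p : nat -> R).
Hypothesis hp : beurling_system p.
Local Notation val := (gint_value p).
Local Notation upto := (upto p).
Local Notation rough_count := (rough_count p).
Local Notation rough_density := (rough_density p).

Lemma lt_prime_count (Y : R) j : (j < prime_count p Y)%N = (p j <= Y).
Proof.
have ex : exists m, Y < p m.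
  by case: hp => _ _ /cvgryPgt/(_ Y) [m _ hm]; exists m; apply: hm => /=.
have e i : (i < ex_minn ex)%N = (p i <= Y).
  case: ex_minnP => m Ym mmin; rewrite [RHS]leNgt.
  have [im|mi] := ltnP i m; first by apply/esym/negP => /mmin; lia.
  by rewrite (lt_le_trans Ym) ?gprime_nondecreasing.
rewrite -e; congr (_ < _)%N; rewrite /prime_count -[RHS](size_iota 0).
apply: perm_size; apply: uniq_perm; rewrite ?fset_uniq ?iota_uniq// => i.
rewrite mem_iota e in_fset_set; last exact: finite_gprimes_le.
by apply/idP/idP => [/set_mem|h]; last exact/mem_set.
Qed.

Lemma prime_count_le (x y : R) : x <= y -> (prime_count p x <= prime_count p y)%N.
Proof.
move=> xy; rewrite leqNgt lt_prime_count; apply/negP => h.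
by have := le_trans h xy; rewrite -lt_prime_count ltnn.
Qed.

Definition mertens_sum (Y : R) : R := \sum_(j < prime_count p Y) ln (p j) / p j.

Lemma mertens_term_ge0 j : 0 <= ln (p j) / p j.
Proof. by rewrite divr_ge0// ltW// ?ln_gprime_gt0 ?gprime_gt0. Qed.

Lemma gsmooth_prime_count n (x : R) : val n <= x -> gsmooth (prime_count p x) n.
Proof.
move=> nx; apply/gsmoothP => j; rewrite leqNgt lt_prime_count; apply: contraNeq.
by rewrite -lt0n => /(gprime_le_gval hp) h; apply: le_trans h nx.
Qed.

Section ChebyshevBound.
Hypothesis hpi : chebyshev_upper p.

(** The Chebyshev bound, in the form in which it limits the concentration of the
primes: each logarithmic window of fixed length has bounded weight.  There are
at most C e^delta X / ln (e^delta X) primes in the window, and each contributes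
at most ln (e^delta X) / X. *)
Lemma mertens_window (delta : R) : 0 < delta ->
  exists2 C, 0 < C & \forall X \near +oo, forall l (P : pred nat),
    (forall j, (j < l)%N -> P j -> X <= p j <= expR delta * X) ->
    \sum_(j < l | P j) ln (p j) / p j <= C.
Proof.
move=> d0; have [C1 hC] := hpi.
have ed := near_pinfty_div (P := fun x => (prime_count p x)%:R <= C1 * (x / ln x))
  (c := expR (- delta)) (expR_gt0 _) hC.
exists (Num.max 1 (C1 * expR delta)); first by rewrite lt_max ltr01.
near=> X => l P HP.
have X1 : 1 < X by near: X; exact: nbhs_pinfty_gt (num_real _).
have X0 : 0 < X by apply: lt_trans X1.
have eX0 : 0 < expR delta * X by rewrite mulr_gt0 ?expR_gt0.
have lX : 0 < ln (expR delta * X).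
  by rewrite ln_gt0// mulr_egt1 // -[ltLHS]expR0 ltr_expR.
have /= cheb : (prime_count p (X / expR (- delta)))%:R <=
    C1 * ((X / expR (- delta)) / ln (X / expR (- delta))) by near: X.
move: cheb; rewrite expRN invrK [X * _]mulrC => cheb.
rewrite le_max; apply/orP; right.
apply: (@le_trans _ _ (\sum_(j < l | P j) ln (expR delta * X) / X)).
  apply: ler_sum => j Pj; have /andP[h1 h2] := HP j (ltn_ord j) Pj.
  apply: ler_pM.
  - by rewrite ltW// ln_gprime_gt0.
  - by rewrite invr_ge0 ltW// gprime_gt0.
  - by rewrite ler_ln ?posrE ?gprime_gt0.
  - by rewrite lef_pV2// posrE gprime_gt0.
rewrite sumr_const -[leLHS]mulr_natl.
have le_card : (#|P : {pred 'I_l}| <= prime_count p (expR delta * X))%N.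
  rewrite -sum1_card -(big_mkord P (fun=> 1%N)) sum1_count -size_filter.
  rewrite -[leqRHS](size_iota 0); apply: uniq_leq_size.
    by rewrite filter_uniq// iota_uniq.
  move=> j; rewrite mem_filter !mem_iota /= add0n subn0 => /andP[Pj jl].
  by rewrite lt_prime_count; have /andP[] := HP j jl Pj.
apply: (@le_trans _ _ (C1 * (expR delta * X / ln (expR delta * X)) *
   (ln (expR delta * X) / X))).
  apply: ler_wpM2r; first by rewrite divr_ge0 ?ltW.
  by apply: le_trans cheb; rewrite ler_nat.
rewrite le_eqVlt; apply/orP; left; apply/eqP; field.
by rewrite !gt_eqF.
Unshelve. all: end_near. Qed.

Lemma mertens_upper : exists2 C, 0 < C & \forall Y \near +oo, mertens_sum Y <= C * ln Y.
Proof.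
have [C C0 /near_pinftyP[X X1 HX]] := mertens_window ltr01.
have X0 : 0 < X by apply: lt_le_trans X1.
have split x y : x <= y -> mertens_sum y = mertens_sum x +
    \sum_(j < prime_count p y | ~~ (j < prime_count p x)%N) ln (p j) / p j.
  move=> xy; rewrite /mertens_sum.
  rewrite [X in _ = X + _](big_ord_widen_cond (prime_count p y) xpredT
    (fun j => ln (p j) / p j)) ?prime_count_le//.
  by rewrite (bigID (fun j : 'I__ => (j < prime_count p x)%N)) /=.
have mono x y : x <= y -> mertens_sum x <= mertens_sum y.
  move=> /split ->; rewrite lerDl; apply: sumr_ge0 => j _.
  exact: mertens_term_ge0.
have e0 : 0 < expR 1 :> R by exact: expR_gt0.
have e1 : 1 <= expR 1 :> R by rewrite -expR0 ler_expR.
have T0 : 0 <= mertens_sum (expR 1 * X).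
  by apply: sumr_ge0 => j _; exact: mertens_term_ge0.
(* The additional factor e keeps each window used in the induction above the
   threshold X. *)
have G : forall x, 1 <= x ->
    mertens_sum (expR 1 * X * x) <= mertens_sum (expR 1 * X) + C * (ln x + 1).
  apply: (@log_growth R (fun x => mertens_sum (expR 1 * X * x))).
  - exact: ltW.
  - move=> x x1; apply: mono; rewrite ler_piMr ?ltW// mulr_gt0//.
  - move=> x x1; have -> : expR 1 * X * (x / expR 1) = X * x by field; rewrite gt_eqF.
    have xX : X <= X * x by rewrite ler_peMr// ltW.
    rewrite (@split (X * x)); last first.
      by rewrite -mulrA ler_peMl// (le_trans (ltW X0) xX).
    rewrite lerD2l; apply: (HX _ xX _ (fun j => ~~ (j < prime_count p (X * x))%N)) => j jl.
    rewrite lt_prime_count -ltNge => /ltW -> /=.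
    by move: jl; rewrite lt_prime_count mulrA.
exists (mertens_sum (expR 1 * X) + C + C); first by rewrite -addrA ltr_wpDl ?addr_gt0.
near=> Y.
have YX : expR 1 * X <= Y by near: Y; exact: nbhs_pinfty_ge (num_real _).
have Ye : expR 1 <= Y by near: Y; exact: nbhs_pinfty_ge (num_real _).
have Y0 : 0 < Y by exact: lt_le_trans Ye.
have lY : 1 <= ln Y by rewrite -[leLHS]expRK ler_ln ?posrE.
have eX0 : 0 < expR 1 * X by rewrite mulr_gt0.
have := G (Y / (expR 1 * X)); rewrite ler_pdivlMr ?mul1r// [_ * (Y / _)]mulrC divfK ?gt_eqF//.
move=> /(_ YX); have : ln (Y / (expR 1 * X)) <= ln Y.
  rewrite ler_ln ?posrE ?divr_gt0// ler_pdivrMr// ler_peMr ?(ltW Y0)//.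
  by apply: mulr_ege1.
move=> h1 h2; apply: le_trans h2 _.
have := ler_wpM2l (ltW C0) h1; have := ler_wpM2l T0 lY; have := ler_wpM2l (ltW C0) lY.
lra.
Unshelve. all: end_near. Qed.

End ChebyshevBound.
End Chebyshev.


(** * The part of an integer composed of small primes *)
Section SmoothPart.
Variables (R : realType) (p : nat -> R).
Hypothesis hp : beurling_system p.
Local Notation val := (gint_value p).
Local Notation upto := (upto p).
Local Notation rough_count := (rough_count p).
Local Notation rough_density := (rough_density p).

Variables (C0 : R).
Hypothesis C0_gt0 : 0 < C0.
Hypothesis count_upper : forall k x, 0 <= x -> rough_count k x <= C0 * x.

(** The constant of the linear bound times the geometric series of 1/p_0, which
dominates that of every 1/p_j. *)
Definition exponent_const : R := C0 / (1 - (p 0%N)^-1).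
Local Notation D := exponent_const.

Lemma exponent_const_gt0 : 0 < D.
Proof.
by rewrite divr_gt0// subr_gt0 invf_lt1 ?gprime_gt0 ?gprime_gt1.
Qed.

(** The multiples of p_j up to x are the p_j m with m <= x / p_j, and the
exponent of p_j drops by one: this gives a recursion in x / p_j. *)
Lemma sum_exponent j x : 0 <= x ->
  \sum_(n <- upto x) (n j)%:R <= D * (x / p j).
Proof.
have pj0 := gprime_gt0 hp j.
move: x; apply: (scale_ind (gprime_gt1 hp j)) => [x x1 x0|x x1 IH x0].
  rewrite upto_lt1// big_seq_fset0; apply: mulr_ge0.
    exact: ltW exponent_const_gt0.
  by rewrite divr_ge0// ltW.
have xp0 : 0 <= x / p j by rewrite divr_ge0// ltW.
rewrite (bigID (fun n => gdvd (gprime j) n && true)) /=.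
rewrite [X in _ + X]big1 ?addr0; last first.
  by move=> n; rewrite andbT gprime_dvd -eqn0Ngt => /eqP ->.
rewrite (big_upto_dvd hp xpredT (fun n : gint => (n j)%:R)) gval_prime.
under eq_bigr do rewrite gmulE gprimeE eqxx natrD.
rewrite big_split /= addrC.
have N1 : \sum_(m <- upto (x / p j)) 1 <= C0 * (x / p j).
  exact: (count_upper 0 xp0).
apply: le_trans (lerD (IH xp0) N1) _.
have -> : D * (x / p j / p j) + C0 * (x / p j) = (D / p j + C0) * (x / p j).
  by field; rewrite gt_eqF.
apply: ler_wpM2r => //.
have hD : D * (1 - (p 0%N)^-1) = C0.
  rewrite /exponent_const divfK// subr_eq0 eq_sym invr_eq1.
  by rewrite gt_eqF// gprime_gt1.
have : D / p j <= D / p 0%N.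
  rewrite ler_wpM2l ?(ltW exponent_const_gt0)//.
  by rewrite lef_pV2 ?posrE ?gprime_gt0// gprime_nondecreasing.
by move: hD; lra.
Qed.

(** First moment of the logarithm of the small-prime part; it serves as upper
bound in [smooth_tail_count], and as lower bound for the Mertens sum, since for
l = pi(x) the small-prime part of n is n itself. *)
Lemma sum_ln_below l x : 0 <= x ->
  \sum_(n <- upto x) ln (val (gbelow l n)) <=
  D * x * \sum_(j < l) ln (p j) / p j.
Proof.
move=> x0.
under eq_bigr do rewrite (ln_gval hp (gbelow_smooth l _)).
rewrite exchange_big mulr_sumr /=; apply: ler_sum => j _.
under eq_bigr do rewrite gbelowE ltn_ord.
rewrite -mulr_suml.
have := sum_exponent j x0.
move=> /(ler_wpM2r (ltW (ln_gprime_gt0 hp j))) h; apply: le_trans h _.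
by rewrite le_eqVlt; apply/orP; left; apply/eqP; field; rewrite gt_eqF ?gprime_gt0.
Qed.

(** Markov's inequality for [sum_ln_below]: few integers have a large part
composed of small primes. *)
Lemma smooth_tail_count l x Z : 0 <= x -> 1 < Z ->
  \sum_(n <- upto x | Z < val (gbelow l n)) 1 <=
  D * x * (\sum_(j < l) ln (p j) / p j) / ln Z.
Proof.
move=> x0 Z1; have lZ : 0 < ln Z by rewrite ln_gt0.
rewrite ler_pdivlMr// mulr_suml; apply: le_trans (sum_ln_below l x0).
apply: ler_sum_upto => // n; last by rewrite ln_ge0// gval_ge1.
move=> _ Zn; split=> //; rewrite mul1r ler_ln ?posrE ?gval_gt0 ?ltW//.
exact: lt_trans Z1.
Qed.

Lemma harmonic_upper x : 1 <= x ->
  \sum_(n <- upto x) (val n)^-1 <= C0 * expR 1 * (ln x + 1).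
Proof.
move=> x1; rewrite -[leRHS]add0r; move: x x1.
have e0 : 0 < expR 1 :> R by exact: expR_gt0.
have e1 : 1 <= expR 1 :> R by rewrite -expR0 ler_expR.
apply: (@log_growth R (fun x => \sum_(n <- upto x) (val n)^-1)).
- by rewrite mulr_ge0// ltW.
- by move=> x x1; rewrite upto_lt1// big_seq_fset0.
move=> x x1; have x0 : 0 < x by apply: lt_le_trans x1.
have xe0 : 0 < x / expR 1 by rewrite divr_gt0.
have xex : x / expR 1 <= x by rewrite ler_pdivrMr// ler_peMr// ltW.
rewrite (big_upto_split hp _ _ xex).
rewrite lerD2l; apply: (@le_trans _ _ (\sum_(n <- upto x) (x / expR 1)^-1)).
  apply: ler_sum_upto => // [n _ xn|n _]; last by rewrite invr_ge0 ltW.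
  by split=> //; rewrite lef_pV2 ?posrE ?gval_gt0// ltW.
have N1 : \sum_(m <- upto x) 1 <= C0 * x.
  exact: (count_upper 0 (ltW x0)).
have -> : \sum_(n <- upto x) (x / expR 1)^-1 =
    (\sum_(n <- upto x) 1) * (x / expR 1)^-1.
  by rewrite mulr_suml; apply: eq_bigr => n _; rewrite mul1r.
apply: le_trans (ler_wpM2r _ N1) _; first by rewrite invr_ge0 ltW.
by rewrite le_eqVlt; apply/orP; left; apply/eqP; field; rewrite !gt_eqF.
Qed.

Variable a : R.
Hypothesis ha : 0 < a.
Hypothesis density : forall e, 0 < e ->
  \forall x \near +oo, `|rough_count 0 x - a * x| <= e * x.

Lemma integer_count_lower : \forall x \near +oo, a * x / 2 <= rough_count 0 x.
Proof.
have h := @rough_count_near R p hp a ha density 0%N (2^-1) ltac:(lra) ltac:(lra).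
apply: filterS h => x /andP[+ _].
by rewrite rough_density0; lra.
Qed.

(** A positive proportion of the integers up to x exceed a fixed fraction of x, so that the sum of ln n
over n <= x is at least a constant times x ln x, whereas [sum_ln_below] bounds
it by a constant times x times the Mertens sum. *)
Lemma mertens_lower :
  exists2 c, 0 < c & \forall x \near +oo, c * ln x <= mertens_sum p x.
Proof.
have D0 := exponent_const_gt0.
exists (a / (8 * D)); first by rewrite divr_gt0// mulr_gt0.
pose kap := a / (4 * C0).
have kap0 : 0 < kap by rewrite divr_gt0// mulr_gt0.
have h1 := integer_count_lower.
near=> x.
have x1 : 1 < x by near: x; exact: nbhs_pinfty_gt (num_real _).
have x0 : 0 < x by apply: lt_trans x1.
have lx0 : 0 < ln x by rewrite ln_gt0.
have h2 : a * x / 2 <= rough_count 0 x by near: x.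
have lnx : - 2 * ln kap <= ln x.
  near: x; apply: (near_pinfty_ln (P := fun y => - 2 * ln kap <= y)).
  exact: nbhs_pinfty_ge (num_real _).
have kx : 1 <= kap^-1 * x.
  rewrite mulrC ler_pdivlMr// mul1r; near: x; exact: nbhs_pinfty_ge (num_real _).
have FM := sum_ln_below (prime_count p x) (ltW x0).
rewrite -/(mertens_sum p x) in FM.
have low : (ln x / 2) * (\sum_(n <- upto x | kap * x < val n) 1) <=
    \sum_(n <- upto x) ln (val (gbelow (prime_count p x) n)).
  rewrite mulr_sumr; apply: ler_sum_upto => // [n nx nk|n _]; last first.
    by rewrite ln_ge0// gval_ge1.
  split=> //; rewrite gbelow_id ?gsmooth_prime_count// mulr1.
  have kx0 : 0 < kap * x by rewrite mulr_gt0.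
  have : ln (kap * x) <= ln (val n) by rewrite ler_ln ?posrE ?gval_gt0// ltW.
  by rewrite lnM ?posrE//; lra.
have cnt : a * x / 4 <= \sum_(n <- upto x | kap * x < val n) 1.
  have := count_upper 0 (x := kap * x) (mulr_ge0 (ltW kap0) (ltW x0)).
  have -> : C0 * (kap * x) = a * x / 4 by rewrite /kap; field; rewrite gt_eqF.
  have [kx1|kx1] := leP (kap * x) x; last first.
    have := rough_count_le hp 0 (ltW kx1); have := mulr_gt0 ha x0.
    move=> ax0 h3 h4; have := le_trans h2 (le_trans h3 h4); lra.
  have := big_upto_split hp (gfree 0) (fun=> 1 : R) kx1.
  rewrite -!rough_countE /= => h3 h4; move: h2; rewrite h3; lra.
have := ler_wpM2l (ltW (divr_gt0 lx0 (ltr0n R 2))) cnt.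
move=> /le_trans /(_ low) /le_trans /(_ FM).
rewrite [X in _ <= X -> _](_ : _ = x * (D * mertens_sum p x)); last by ring.
rewrite (_ : ln x / 2 * (a * x / 4) = x * (D * (a / (8 * D) * ln x))); last first.
  by field; rewrite gt_eqF.
by rewrite !ler_pM2l.
Unshelve. all: end_near. Qed.

(** The asymptotic count of the integers free of the first k primes, read in one
logarithmic window; half of the window suffices, which avoids its open end. *)
Lemma window_weight (delta : R) (k : nat) : 0 < delta ->
  exists i0 : nat, forall i : nat, (i0 <= i)%N -> forall Y,
  expR (i.+1%:R * delta) <= Y ->
  a * delta / 4 * expR (- (delta / 2)) * rough_density k <=
  \sum_(n <- upto Y | gfree k n && (Num.truncn (ln (val n) / delta) == i))
    (val n)^-1.
Proof.
(* chosen so that (1 - kap) (1 + delta / 2) - (1 + kap) = delta / 4 *)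
move=> d0; pose kap := delta / (8 + 2 * delta).
have kap0 : 0 < kap by rewrite divr_gt0//; lra.
have kap1 : kap < 1 by rewrite ltr_pdivrMr; lra.
have /near_pinftyP[X X1 HX] := @rough_count_near R p hp a ha density k kap kap0 kap1.
exists (Num.truncn (ln X / delta)).+1 => i iX Y iY.
set y := expR (i%:R * delta).
have y0 : 0 < y by exact: expR_gt0.
have Xy : X <= y.
  rewrite -[X]lnK ?posrE; last by apply: lt_le_trans X1.
  rewrite ler_expR -ler_pdivrMr//; apply: ltW.
  apply: lt_le_trans (truncnS_gt _) _; by rewrite ler_nat.
set y' := expR (delta / 2) * y.
have ed : 1 + delta / 2 <= expR (delta / 2) by exact: expR_ge1Dx.
have yy' : y <= y' by rewrite ler_peMl ?ltW//; lra.
have y'0 : 0 < y' by exact: lt_le_trans yy'.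
have y'Y : y' <= Y.
  apply: le_trans iY; rewrite /y' /y -expRD ler_expR -[i.+1%:R]natr1 mulrDl mul1r; lra.
have w0 := rough_density_gt0 hp k.
have aw0 : 0 < a * rough_density k by rewrite mulr_gt0.
have /andP[_ h1] := HX _ Xy; have /andP[h2 _] := HX _ (le_trans Xy yy').
have cnt : a * rough_density k * y * (delta / 4) <=
    \sum_(n <- upto y' | gfree k n && (y < val n)) 1.
  have := big_upto_split hp (gfree k) (fun=> 1 : R) yy'.
  rewrite -!rough_countE /= => h3; move: h2; rewrite h3.
  have : (1 - kap) * (a * rough_density k * ((1 + delta / 2) * y)) <=
     (1 - kap) * (a * rough_density k * y').
    by rewrite ler_pM2l ?subr_gt0// ler_pM2l// ler_pM2r.
  have : (1 - kap) * (1 + delta / 2) - (1 + kap) = delta / 4.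
    by rewrite /kap; field; lra.
  move=> e h4 h5.
  have : a * rough_density k * y * (delta / 4) =
   (1 - kap) * (a * rough_density k * ((1 + delta / 2) * y)) -
   (1 + kap) * (a * rough_density k * y) by rewrite -e; ring.
  by move=> ->; lra.
apply: (@le_trans _ _ (y'^-1 * \sum_(n <- upto y' | gfree k n && (y < val n)) 1)).
  rewrite [leRHS]mulrC ler_pdivlMr//; apply: le_trans cnt.
  rewrite le_eqVlt; apply/orP; left; apply/eqP.
  by rewrite /y' expRN; field; rewrite gt_eqF ?expR_gt0.
rewrite mulr_sumr; apply: (@le_trans _ _ (\sum_(n <- upto Y | gfree k n && (y < val n) && (val n <= y')) y'^-1)).
  rewrite (big_upto_split hp _ _ y'Y).
  under eq_bigr do rewrite mulr1.
  rewrite -[leLHS]addr0 lerD//; last by apply: sumr_ge0 => n _; rewrite invr_ge0 ltW.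
  apply: ler_sum_upto => // [n ny ->|n _]; last by rewrite invr_ge0 ltW.
  by rewrite ny.
apply: ler_sum_upto => // [n _ /andP[/andP[fn yn] ny]|n _]; last first.
  by rewrite invr_ge0 ltW// gval_gt0.
rewrite fn lef_pV2 ?posrE ?gval_gt0//; split=> //=.
rewrite truncn_eq; last by rewrite divr_ge0 ?ln_ge0 ?gval_ge1 ?ltW.
have v0 := gval_gt0 hp n.
have -> : i%:R <= ln (val n) / delta.
  by rewrite ler_pdivlMr// -[leLHS]expRK ler_ln ?posrE// ltW.
rewrite ltr_pdivrMr// -[ltRHS]expRK ltr_ln ?posrE ?expR_gt0//.
apply: le_lt_trans ny _; rewrite /y' /y -expRD ltr_expR -[i.+1%:R]natr1 mulrDl mul1r; lra.
Qed.

Hypothesis hpi : chebyshev_upper p.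

(** With l = pi(Y), the Chebyshev bound and [smooth_tail_count] show that a
positive proportion of the integers n up to x have a small-prime part d at most
Y^A.  Summed over d these n are about a w_l x times the harmonic sum up to Y^A,
where w_l is the density factor; that sum is O(ln Y), so w_l cannot be much
smaller than 1 / ln Y. *)
Lemma rough_density_lower :
  exists2 c, 0 < c & \forall Y \near +oo,
    c <= rough_density (prime_count p Y) * ln Y.
Proof.
have D0 := exponent_const_gt0.
have [C2 C20 hC2] := mertens_upper hp hpi.
pose A := 4 * D * C2 / a.
have A0 : 0 < A by rewrite divr_gt0// mulr_gt0// mulr_gt0.
have H0 : 0 < C0 * expR 1 by rewrite mulr_gt0 ?expR_gt0.
exists (a / (8 * (a * (C0 * expR 1)) * (A + 1))).
  by rewrite divr_gt0 ?mulr_gt0 ?addr_gt0 ?expR_gt0.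
near=> Y.
have Ye : expR 1 <= Y by near: Y; exact: nbhs_pinfty_ge (num_real _).
have Y0 : 0 < Y by apply: lt_le_trans Ye; exact: expR_gt0.
have lY : 1 <= ln Y by rewrite -[leLHS]expRK ler_ln ?posrE ?expR_gt0.
have hM : mertens_sum p Y <= C2 * ln Y by near: Y.
set l := prime_count p Y.
pose Z := expR (A * ln Y).
have lZ : ln Z = A * ln Y by rewrite expRK.
have Alz : 0 < A * ln Y by rewrite mulr_gt0//; lra.
have Z1 : 1 < Z by rewrite -[ltLHS]expR0 ltr_expR.
have w0 := rough_density_gt0 hp l.
have h1 := integer_count_lower.
have /near_pinftyP[X X1 HX] :=
  @rough_count_near R p hp a ha density l (2^-1) ltac:(lra) ltac:(lra).
have /near_pinftyP[X' X'1 HX'] := h1.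
(* x is large enough for the asymptotic count to hold at all x / d, d <= Z *)
pose x := Num.max X' (X * Z).
have Z0 : 0 < Z by apply: lt_trans Z1.
have x0 : 0 < x by rewrite lt_max (lt_le_trans _ X'1).
have xX' : a * x / 2 <= rough_count 0 x by apply: HX'; rewrite le_max lexx.
have xXZ : X * Z <= x by rewrite le_max lexx orbT.
have tail : \sum_(n <- upto x | Z < val (gbelow l n)) 1 <= a * x / 4.
  apply: le_trans (smooth_tail_count l (ltW x0) Z1) _.
  rewrite lZ ler_pdivrMr// -/(mertens_sum p Y).
  have -> : a * x / 4 * (A * ln Y) = D * x * (C2 * ln Y).
    by rewrite /A; field; rewrite gt_eqF.
  by rewrite ler_pM2l// mulr_gt0.
have head : a * x / 4 <=
    \sum_(n <- upto x | gfree 0 n) (if val (gbelow l n) <= Z then 1 else 0).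
  move: xX'; rewrite {1}rough_countE.
  rewrite (bigID (fun n => Z < val (gbelow l n))) /= => h2.
  have h3 : \sum_(n <- upto x | gfree 0 n && (Z < val (gbelow l n))) 1 <= a * x / 4.
    by apply: le_trans tail; apply: ler_sum_upto.
  have : a * x / 4 <= \sum_(n <- upto x | gfree 0 n && ~~ (Z < val (gbelow l n))) 1.
    by move: h2 h3; lra.
  move=> /le_trans; apply; rewrite -big_mkcondr /=.
  by apply: ler_sum_upto => // n _; rewrite -leNgt.
move: head; rewrite (big_upto_below hp _ _ (leq0n l)) => head.
have {head} : a * x / 4 <= \sum_(d <- upto Z) 2 * (a * rough_density l * (x / val d)).
  apply: le_trans head _.
  apply: (@le_trans _ _ (\sum_(d <- upto x | val d <= Z) 2 * (a * rough_density l * (x / val d)))).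
    rewrite big_mkcond [leRHS]big_mkcond /= big_seq [leRHS]big_seq; apply: ler_sum => d.
    rewrite in_upto// => dx.
    case: ifPn => [/andP[sd _]|_]; last first.
      case: ifP => // _; rewrite !mulr_ge0 ?ltW// invr_gt0; exact: gval_gt0.
    under eq_bigr => m fm.
      have /eqP -> : gbelow l (gmul d m) == d by rewrite gbelow_mul.
      over.
    case: ifP => dZ; last by rewrite big1.
    rewrite -rough_countE.
    have /HX/andP[_] : X <= x / val d.
      rewrite ler_pdivlMr ?gval_gt0//; apply: le_trans xXZ.
      by rewrite ler_pM2l// (lt_le_trans _ X1).
    move=> /le_trans; apply; rewrite ler_pM2r; first lra.
    by rewrite !mulr_gt0// invr_gt0 gval_gt0.
  have Zx : Z <= x by apply: le_trans xXZ; rewrite ler_peMl// ltW.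
  rewrite (big_upto_split hp _ _ Zx) /= [X in _ + X <= _]big1 ?addr0.
    by apply: ler_sum_upto => // n _; rewrite !mulr_ge0 ?ltW ?invr_gt0 ?gval_gt0.
  by move=> n /andP[nZ]; rewrite ltNge nZ.
rewrite -mulr_sumr -mulr_sumr -mulr_sumr => h2.
have h3 := harmonic_upper (ltW Z1).
have : a * x / 4 <= 2 * (a * rough_density l * (x * (C0 * expR 1 * ((A + 1) * ln Y)))).
  apply: le_trans h2 _; rewrite ler_pM2l//.
  rewrite ler_pM2l ?mulr_gt0// ler_pM2l//; apply: le_trans h3 _.
  rewrite ler_pM2l// lZ; lra.
move=> h4; rewrite ler_pdivrMr ?mulr_gt0 ?addr_gt0//.
have : x * a <= x * (rough_density l * ln Y * (8 * (a * (C0 * expR 1)) * (A + 1))).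
  by move: h4; rewrite -[leLHS]mulrC; lra.
by rewrite ler_pM2l.
Unshelve. all: end_near. Qed.

End SmoothPart.


(** * Moduli of complex numbers *)
Import Normc.
Local Notation Re := complex.Re.
Local Notation "r %:C" := (real_complex _ r) : ring_scope.

Section Modulus.
Variable R : realType.
Implicit Types (x y w : R[i]) (r : R).

Lemma normc_ge0 x : 0 <= normc x.
Proof. by case: x => u v; exact: sqrtr_ge0. Qed.

Lemma normc_leD x y : normc (x + y) <= normc x + normc y.
Proof. exact: (@le_normcD R x y). Qed.

Lemma normc_opp x : normc (- x) = normc x.
Proof. exact: (@normcN R x). Qed.

Lemma normc_leB x y : normc (x - y) <= normc x + normc y.
Proof. by rewrite -[normc y]normc_opp normc_leD. Qed.

Lemma normc_real r : 0 <= r -> normc r%:C = r.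
Proof. by move=> r0; rewrite /= expr0n addr0 sqrtr_sqr ger0_norm. Qed.

Lemma normcX x n : normc (x ^+ n) = normc x ^+ n.
Proof. by elim: n => [|n IH]; [exact: normc1|rewrite !exprS normcM IH]. Qed.

Lemma normc_sum (I : Type) (r : seq I) (P : pred I) (F : I -> R[i]) :
  normc (\sum_(i <- r | P i) F i) <= \sum_(i <- r | P i) normc (F i).
Proof.
elim/big_ind2: _ => [|x1 x2 y1 y2 h1 h2|//]; first by rewrite normc0.
exact: le_trans (normc_leD _ _) (lerD h1 h2).
Qed.

Lemma Re_sum (I : Type) (r : seq I) (P : pred I) (F : I -> R[i]) :
  Re (\sum_(i <- r | P i) F i) = \sum_(i <- r | P i) Re (F i).
Proof. by apply: (big_morph (@complex.Re R)) => // -[u v] [u' v']. Qed.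

Lemma Re_le_normc x : Re x <= normc x.
Proof.
case: x => u v /=; apply: le_trans (ler_norm u) _.
by rewrite -sqrtr_sqr ler_wsqrtr// lerDl sqr_ge0.
Qed.

Lemma Re_mul_real x r : Re (x * r%:C) = Re x * r.
Proof. by case: x => u v /=; rewrite mulr0 subr0. Qed.

Lemma sqr_normc_sub_real x r :
  normc (x - r%:C) ^+ 2 = normc x ^+ 2 - 2 * r * Re x + r ^+ 2.
Proof.
case: x => u v /=; rewrite !sqr_sqrtr ?addr_ge0 ?sqr_ge0//; ring.
Qed.

(** Allows a lower bound on a modulus to be read off from real parts, which
are additive. *)
Lemma rotate_to_real w : exists2 u, normc u = 1 & u * w = (normc w)%:C.
Proof.
have [->|w0] := eqVneq w 0.
  by exists 1; [exact: normc1|rewrite mulr0 normc0].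
have n0 : normc w != 0 by apply: contraNneq w0 => /eq0_normc ->.
exists ((normc w)%:C / w); last by rewrite divfK.
by rewrite normcM normcV normc_real ?normc_ge0// divff.
Qed.

(** The powers of z form a finite set. *)
Lemma powers_separated (z : R[i]) (K : nat) : (0 < K)%N -> z ^+ K = 1 ->
  exists sig : R, [/\ 0 < sig, sig <= 1 & forall i j,
    normc (z ^+ i - z ^+ j) < sig -> z ^+ i = z ^+ j].
Proof.
move=> K0 zK.
pose D (ij : 'I_K * 'I_K) : R := normc (z ^+ ij.1 - z ^+ ij.2).
exists (\big[Order.min/1]_(ij : 'I_K * 'I_K | z ^+ ij.1 != z ^+ ij.2) D ij); split.
- elim/big_rec: _ => // ij x ne x0; rewrite lt_min x0 andbT lt_def normc_ge0 andbT.
  by apply: contra ne => /eqP /eq0_normc /eqP; rewrite subr_eq0.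
- by elim/big_rec: _ => // ij x _ x1; rewrite ge_min x1 orbT.
move=> i j; apply: contraPP => /eqP ne; apply/negP; rewrite -leNgt.
rewrite -(expr_mod i zK) -(expr_mod j zK).
pose ij := (Ordinal (ltn_pmod i K0), Ordinal (ltn_pmod j K0)).
have neij : z ^+ ij.1 != z ^+ ij.2 by rewrite /= !expr_mod.
change (normc _) with (D ij).
have := @bigmin_le_cond _ R _ 1 ij
  (fun ij : 'I_K * 'I_K => z ^+ ij.1 != z ^+ ij.2) D neij.
by move=> h; apply: h.
Qed.

End Modulus.

(** * Means of the powers of a unimodular number over rough integers *)
Section MeanValue.
Variables (R : realType) (p : nat -> R).
Hypothesis hp : beurling_system p.
Local Notation val := (gint_value p).
Local Notation upto := (upto p).
Local Notation rough_count := (rough_count p).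
Local Notation rough_density := (rough_density p).

Variable z : R[i].
Hypothesis z_norm : normc z = 1.

Lemma normc_z n : normc (z ^+ n) = 1.
Proof. by rewrite normcX z_norm expr1n. Qed.

Definition rough_mean (k : nat) (x : R) : R[i] :=
  \sum_(n <- upto x | gfree k n) z ^+ num_prime_factors n.

Lemma rough_mean_le k x : normc (rough_mean k x) <= rough_count k x.
Proof.
rewrite /rough_mean rough_countE.
have := normc_sum (upto x) (gfree k) (fun n => z ^+ num_prime_factors n).
move=> /le_trans; apply.
apply: ler_sum => n _.
by rewrite normc_z.
Qed.

Lemma rough_mean_diff k x y : x <= y ->
  normc (rough_mean k y - rough_mean k x) <= rough_count k y - rough_count k x.
Proof.
move=> xy; rewrite /rough_mean !rough_countE.
have sub (S : zmodType) (F : gint -> S) : \sum_(n <- upto y | gfree k n) F n -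
    \sum_(n <- upto x | gfree k n) F n =
    \sum_(n <- upto y | gfree k n && (x < val n)) F n.
  by rewrite (big_upto_split hp _ _ xy) addrAC subrr add0r.
rewrite !sub; have h := normc_sum (upto y) (fun n => gfree k n && (x < val n))
  (fun n => z ^+ num_prime_factors n).
by apply: (le_trans h); apply: ler_sum => n _; rewrite normc_z.
Qed.

Lemma rough_mean_below k l x : (k <= l)%N ->
  rough_mean k x = \sum_(d <- upto x | gsmooth l d && gfree k d)
    z ^+ num_prime_factors d * rough_mean l (x / val d).
Proof.
move=> kl; rewrite /rough_mean (big_upto_below hp _ _ kl).
apply: eq_bigr => d _; rewrite mulr_sumr; apply: eq_bigr => m _.
by rewrite num_prime_factors_mul exprD.
Qed.

Lemma rough_count_below k l x : (k <= l)%N ->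
  rough_count k x = \sum_(d <- upto x | gsmooth l d && gfree k d)
    rough_count l (x / val d).
Proof. by move=> kl; rewrite !rough_countE (big_upto_below hp _ _ kl). Qed.

Definition mean_ratio (l : nat) (y : R) : R[i] :=
  rough_mean l y * ((rough_count l y)^-1)%:C.

(** The terms that separate the means at y and y' number N(y') - N(y). *)
Lemma mean_ratio_lipschitz l y y' : y <= y' -> 0 < rough_count l y ->
  normc (mean_ratio l y - mean_ratio l y') <=
  2 * (1 - rough_count l y / rough_count l y').
Proof.
move=> yy' N0; have NN' := rough_count_le hp l yy'.
have N'0 : 0 < rough_count l y' by exact: lt_le_trans NN'.
set N := rough_count l y in N0 NN' *; set N' := rough_count l y' in NN' N'0 *.
have -> : mean_ratio l y - mean_ratio l y' =
    rough_mean l y * (N^-1 - N'^-1)%:C -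
    (rough_mean l y' - rough_mean l y) * (N'^-1)%:C.
  by rewrite /mean_ratio -/N -/N' rmorphB /=; ring.
apply: le_trans (normc_leB _ _) _; rewrite !normcM !normc_real; last 2 first.
- by rewrite invr_ge0 ltW.
- by rewrite subr_ge0 lef_pV2.
have h1 := ler_wpM2r (_ : 0 <= N^-1 - N'^-1) (rough_mean_le l y).
have h2 := ler_wpM2r (_ : 0 <= N'^-1) (rough_mean_diff l yy').
apply: le_trans (lerD (h1 _) (h2 _)) _.
- by rewrite subr_ge0 lef_pV2.
- by rewrite invr_ge0 ltW.
rewrite -/N -/N' le_eqVlt; apply/orP; left; apply/eqP; field.
by rewrite !gt_eqF.
Qed.

(** Over all smooth d <= x the terms add up to s' N_k(x) - |M_k(x)|.  Those with
x / d >= y0, among them all with d <= Y, are nonnegative.  The others are at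
least - N_l(x / d), and these counts add up to at most the number of n whose
small-prime part exceeds x / y0. *)
Lemma deficiency_sum (s' : R) (k l : nat) (Y y0 x : R) (u : R[i]) :
  (k <= l)%N -> l = prime_count p Y -> 0 <= Y -> 1 <= y0 -> Y * y0 <= x -> normc u = 1 ->
  u * rough_mean k x = (normc (rough_mean k x))%:C ->
  0 <= s' -> (forall y, y0 <= y -> normc (rough_mean l y) <= s' * rough_count l y) ->
  \sum_(d <- upto Y | gfree k d) (s' * rough_count l (x / val d) -
      Re (u * z ^+ num_prime_factors d * rough_mean l (x / val d))) <=
  s' * rough_count k x - normc (rough_mean k x) +
  \sum_(n <- upto x | x / y0 < val (gbelow l n)) 1.
Proof.
move=> kl lY Y0 y01 Yx u1 uM s0 bnd.
have y00 : 0 < y0 by exact: lt_le_trans y01.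
have Yx' : Y <= x by apply: le_trans Yx; rewrite ler_peMr.
set T := fun d : gint => s' * rough_count l (x / val d) -
      Re (u * z ^+ num_prime_factors d * rough_mean l (x / val d)).
have ReT d : Re (u * z ^+ num_prime_factors d * rough_mean l (x / val d)) <=
    normc (rough_mean l (x / val d)).
  by apply: le_trans (Re_le_normc _) _; rewrite !normcM u1 normc_z !mul1r.
have total : \sum_(d <- upto x | gsmooth l d && gfree k d) T d =
    s' * rough_count k x - normc (rough_mean k x).
  rewrite /T sumrB (rough_count_below x kl) mulr_sumr; congr (_ - _).
  rewrite -Re_sum.
  have -> : normc (rough_mean k x) = Re (u * rough_mean k x) by rewrite uM.
  rewrite [in RHS](rough_mean_below x kl) mulr_sumr; congr Re.
  by apply: eq_bigr => d _; rewrite mulrA.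
have T0 d : val d <= x / y0 -> 0 <= T d.
  move=> dx; rewrite subr_ge0; apply: le_trans (ReT d) _; apply: bnd.
  by rewrite ler_pdivlMr ?gval_gt0// mulrC -ler_pdivlMr.
have Yxy : Y <= x / y0 by rewrite ler_pdivlMr.
have Tneg d : - T d <= rough_count l (x / val d).
  rewrite /T opprB; have := ReT d; have := rough_mean_le l (x / val d).
  have := mulr_ge0 s0 (rough_count_ge0 p l (x / val d)); lra.
have tail : \sum_(d <- upto x | gsmooth l d && gfree k d && (x / y0 < val d))
      rough_count l (x / val d) <=
    \sum_(n <- upto x | x / y0 < val (gbelow l n)) 1.
  apply: (@le_trans _ _ (\sum_(n <- upto x | gfree k n)
     if x / y0 < val (gbelow l n) then 1 else 0)); last first.
    rewrite -big_mkcondr; apply: ler_sum_upto => // n _ /andP[] //.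
  rewrite (big_upto_below hp _ _ kl) big_mkcondr /=; apply: ler_sum => d /andP[sd _].
  under [leRHS]eq_bigr => m fm.
    have /eqP -> : gbelow l (gmul d m) == d by rewrite gbelow_mul.
    over.
  by case: ifP => //; rewrite big1.
have part : \sum_(d <- upto Y | gfree k d) T d <=
    \sum_(d <- upto x | gsmooth l d && gfree k d && ~~ (x / y0 < val d)) T d.
  apply: le_trans (ler_upto hp (x := Y) Yx' _); last first.
    by move=> d /andP[_]; rewrite -leNgt => /T0.
  apply: ler_sum_upto => // [d dY fd|d /andP[_]]; last by rewrite -leNgt => /T0.
  by rewrite lY gsmooth_prime_count// fd -leNgt (le_trans dY Yxy).
rewrite -total [X in _ <= X + _](bigID (fun d => x / y0 < val d)) /=.
have := sumrN (upto x) (fun d => gsmooth l d && gfree k d && (x / y0 < val d)) T.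
have : \sum_(d <- upto x | gsmooth l d && gfree k d && (x / y0 < val d)) - T d <=
   \sum_(d <- upto x | gsmooth l d && gfree k d && (x / y0 < val d))
      rough_count l (x / val d) by apply: ler_sum.
by move: part tail; lra.
Qed.

End MeanValue.


(** * Local constancy at the extremal mean *)
Section Rigidity.
Variables (R : realType) (p : nat -> R).
Hypothesis hp : beurling_system p.
Local Notation val := (gint_value p).
Local Notation upto := (upto p).
Local Notation rough_count := (rough_count p).
Local Notation rough_density := (rough_density p).
Variables (a : R) (z : R[i]).
Hypothesis ha : 0 < a.
Hypothesis density : forall e, 0 < e ->
  \forall x \near +oo, `|rough_count 0 x - a * x| <= e * x.
Hypothesis z_norm : normc z = 1.
Local Notation rough_mean := (rough_mean p z).

(** s is the infimum of the numbers that asymptotically bound all the ratios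
|M_l| / N_l at once. *)
Lemma extremal_mean_bound :
  ~ (forall e, 0 < e -> \forall x \near +oo,
       normc (rough_mean 0 x) <= e * rough_count 0 x) ->
  exists s : R, [/\ 0 < s, s <= 1,
    forall eta l, 0 < eta -> \forall x \near +oo,
      normc (rough_mean l x) <= (s + eta) * rough_count l x &
    forall eta, 0 < eta -> eta <= s -> exists k,
      ~ \forall x \near +oo, normc (rough_mean k x) <= (s - eta) * rough_count k x].
Proof.
move=> hneg.
pose S : set R := [set t | 0 <= t /\ forall l, \forall x \near +oo,
  normc (rough_mean l x) <= t * rough_count l x].
have S1 : S 1.
  split=> // l; apply/near_pinftyP; exists 1 => // x _.
  by rewrite mul1r; exact: rough_mean_le.
have lbS : lbound S 0 by move=> t [].
have infS : has_inf S by split; [exists 1|exists 0].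
have s0 : 0 <= inf S by apply: lb_le_inf => //; exists 1.
have adh e : 0 < e -> exists2 t, S t & t < inf S + e by move=> e0; exact: inf_adherent.
have up eta l : 0 < eta -> \forall x \near +oo,
    normc (rough_mean l x) <= (inf S + eta) * rough_count l x.
  move=> /adh[t [_ tS] te]; apply: filterS (tS l) => x /le_trans; apply.
  by rewrite ler_wpM2r ?rough_count_ge0// ltW.
have s_gt0 : 0 < inf S.
  rewrite lt_def s0 andbT; apply/negP => /eqP e0; apply: hneg => e e_gt0.
  by have := up e 0%N e_gt0; rewrite e0 add0r.
exists (inf S); split=> //; first exact: (ge_inf infS.2 S1).
move=> eta eta0 etas.
have nS : ~ S (inf S - eta).
  by move=> /(ge_inf infS.2); lra.
by apply: contra_notP nS => /forallNP nk; split; [rewrite subr_ge0|move=> l; apply: contrapT].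
Qed.

Hypothesis hpi : chebyshev_upper p.
Variable K : nat.
Hypothesis K_gt0 : (0 < K)%N.
Hypothesis zK : z ^+ K = 1.

(** Since N_l is asymptotically linear, N_l(y) / N_l(y') is nearly y / y', and
[mean_ratio_lipschitz] applies. *)
Lemma ratio_almost_constant (l : nat) (rho : R) : 0 < rho -> rho <= 1 ->
  \forall y \near +oo, forall y', y <= y' -> y' <= expR (rho / 2) * y ->
    normc (mean_ratio p z l y - mean_ratio p z l y') <= 2 * rho.
Proof.
move=> rho0 rho1.
have kap0 : 0 < rho / 4 by lra.
have kap1 : rho / 4 < 1 by lra.
have /near_pinftyP[X X1 HX] := rough_count_near hp ha density l kap0 kap1.
apply/near_pinftyP; exists X => // y Xy y' yy' y'y.
have y0 : 0 < y by apply: lt_le_trans Xy; lra.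
have w0 := rough_density_gt0 hp l.
have aw0 : 0 < a * rough_density l by rewrite mulr_gt0.
have /andP[h1 _] := HX _ Xy; have /andP[h2 h2'] := HX _ (le_trans Xy yy').
have N0 : 0 < rough_count l y.
  by apply: lt_le_trans h1; rewrite !mulr_gt0//; lra.
have N'0 : 0 < rough_count l y' by apply: lt_le_trans N0 (rough_count_le hp l yy').
apply: le_trans (mean_ratio_lipschitz hp z_norm yy' N0) _.
rewrite ler_pM2l// lerBlDl -lerBlDr ler_pdivlMr//.
have e0 : 0 < expR (rho / 2) by exact: expR_gt0.
have ee : (1 - rho / 2) * expR (rho / 2) <= 1.
  have := expR_ge1Dx (- (rho / 2)); rewrite expRN => h.
  by rewrite -ler_pdivlMr// mul1r; apply: le_trans h.
set E := expR (rho / 2) in y'y e0 ee *.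
have h3 : rough_count l y' <= (1 + rho / 4) * (a * rough_density l * (E * y)).
  by apply: le_trans h2' _; rewrite ler_pM2l ?ler_pM2l//; lra.
have [r1|r1] := leP (1 - rho) 0.
  by apply: le_trans (_ : _ <= 0) (ltW N0); rewrite mulr_le0_ge0// ltW.
have {}h3 := ler_wpM2l (ltW r1) h3.
apply: (le_trans h3); apply: le_trans h1.
have k1 : (1 - rho) * (1 + rho / 4) * E <= (1 - rho / 4) * ((1 - rho / 2) * E).
  rewrite mulrA ler_pM2r// (_ : (1 - rho / 4) * _ = (1 - rho) * (1 + rho / 4) +
    3 / 8 * rho ^+ 2); last by field.
  by rewrite lerDl mulr_ge0 ?sqr_ge0//; lra.
have k2 : (1 - rho) * (1 + rho / 4) * E <= 1 - rho / 4.
  by apply: (le_trans k1); rewrite ler_piMr//; lra.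
have := ler_wpM2r (ltW (mulr_gt0 aw0 y0)) k2.
by move=> /(le_trans _); apply; rewrite le_eqVlt; apply/orP; left; apply/eqP; ring.
Qed.

Lemma frequently_pinfty (P Q : R -> Prop) :
  ~ (\forall x \near +oo, P x) -> (\forall x \near +oo, Q x) ->
  exists2 x, Q x & ~ P x.
Proof.
move=> nP nQ; apply: contrapT => H; apply: nP; apply: filterS nQ => x Qx.
by apply: contrapT => nPx; apply: H; exists x.
Qed.

(** At a large x where |M_k(x)| nearly attains s N_k(x), let h(d) be the ratio
M_l / N_l at x / d and u the unit that makes u M_k(x) real.  An integer d is
good when u z^Omega(d) h(d) is close to s.  Every bad d contributes at least a
constant times 1/d to the sum of [deficiency_sum], which is small; and for two
good integers d, d' with d'/d close to 1 the values h(d), h(d') are close, hence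
z^Omega(d), z^Omega(d') are closer than two distinct powers of z can be. *)
Lemma locally_constant_residue :
  ~ (forall e, 0 < e -> \forall x \near +oo,
       normc (rough_mean 0 x) <= e * rough_count 0 x) ->
  exists2 delta : R, 0 < delta & forall eps, 0 < eps -> exists k,
    \forall Y \near +oo, exists good : pred gint,
    \sum_(d <- upto Y | gfree k d && ~~ good d) (val d)^-1 <=
      eps * (rough_density k * ln Y) /\
    forall d d', val d <= Y -> val d' <= Y -> good d -> good d' ->
      val d <= val d' -> val d' <= expR (3 * delta) * val d ->
      z ^+ num_prime_factors d = z ^+ num_prime_factors d'.
Proof.
move=> /extremal_mean_bound[s [s0 s1 up low]].
have [C0 C0_gt0 count_upper] := integer_count_upper hp ha density.
have [sig [sig0 sig1 sep]] := powers_separated K_gt0 zK.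
have [c3 c30 hc3] := rough_density_lower hp C0_gt0 count_upper ha density hpi.
pose rho := sig * s / 4.
have rho0 : 0 < rho by rewrite !mulr_gt0.
have rhos : rho <= s / 4 by rewrite ler_pM2r// ler_piMl// ltW.
have rho1 : rho <= 1 by lra.
exists (rho / 6) => [|eps eps0]; first by lra.
have -> : 3 * (rho / 6) = rho / 2 by field.
(* The first bound makes each bad d lose at least rho^2 / 4 times N_l(x / d);
   the second makes the total loss, 4 eta a w_k x, small compared with eps. *)
pose eta := Num.min (rho / 2) (eps * rho ^+ 2 * c3 / 48).
have eta0 : 0 < eta.
  by rewrite lt_min; apply/andP; split; [lra|rewrite divr_gt0// !mulr_gt0// exprn_gt0].
have eta1 : eta <= rho / 2 by rewrite ge_min lexx.
have eta2 : eta <= eps * rho ^+ 2 * c3 / 48 by rewrite ge_min lexx orbT.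
have [|k lowk] := low eta eta0; first by lra.
exists k; near=> Y.
have Y1 : expR 1 <= Y by near: Y; exact: nbhs_pinfty_ge (num_real _).
have e1 : 1 <= expR 1 :> R by rewrite -expR0 ler_expR.
have Y0 : 0 < Y by lra.
have lY : 1 <= ln Y by rewrite -[leLHS]expRK ler_ln ?posrE ?expR_gt0.
have pkY : p k <= Y by near: Y; exact: nbhs_pinfty_ge (num_real _).
have /= hw : c3 <= rough_density (prime_count p Y) * ln Y by near: Y.
set l := prime_count p Y in hw.
have kl : (k <= l)%N by apply: ltnW; rewrite lt_prime_count.
have wl0 := rough_density_gt0 hp l; have wk0 := rough_density_gt0 hp k.
have h2 : 0 < 2^-1 :> R by lra.
have h2' : 2^-1 < 1 :> R by lra.
have n1 := up eta l eta0.
have n2 := rough_count_near hp ha density l h2 h2'.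
have n3 := ratio_almost_constant l rho0 rho1.
have n123 : \forall y \near +oo,
    normc (rough_mean l y) <= (s + eta) * rough_count l y /\
    (1 - 2^-1) * (a * rough_density l * y) <= rough_count l y /\
    forall y', y <= y' -> y' <= expR (rho / 2) * y ->
      normc (mean_ratio p z l y - mean_ratio p z l y') <= 2 * rho.
  near=> y; split; first by near: y.
  by split; [have /andP[] : (1 - 2^-1) * (a * rough_density l * y) <= rough_count l y <=
    (1 + 2^-1) * (a * rough_density l * y) by near: y|near: y].
have [y0 y01 Hy0] := (near_pinftyP _).1 n123.
have y00 : 0 < y0 by lra.
pose D := exponent_const p C0; pose M := \sum_(j < l) ln (p j) / p j.
have D0 : 0 < D by exact: exponent_const_gt0.
have M0 : 0 <= M by apply: sumr_ge0 => j _; exact: mertens_term_ge0.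
have aw0 : 0 < a * rough_density k by rewrite mulr_gt0.
have nx : \forall x \near +oo, (1 <= x) /\ (Y * y0 <= x) /\
    ((1 - 2^-1) * (a * rough_density k * x) <= rough_count k x <=
     (1 + 2^-1) * (a * rough_density k * x)) /\
    (1 < x / y0 /\ D * M * 2 / (eta * (a * rough_density k)) <= ln (x / y0)).
  apply: filterI; first exact: nbhs_pinfty_ge (num_real _).
  apply: filterI; first exact: nbhs_pinfty_ge (num_real _).
  apply: filterI; first exact: rough_count_near.
  apply: (near_pinfty_div (P := fun t => 1 < t /\ _ <= ln t)) => //.
  apply: filterI; first exact: nbhs_pinfty_gt (num_real _).
  apply: (near_pinfty_ln (P := fun t => _ <= t)).
  exact: nbhs_pinfty_ge (num_real _).
have [x [x1 [Yx [/andP[_ Nkx] [xy0 tlx]]]] /negP] := frequently_pinfty lowk nx.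
rewrite -ltNge => lowx.
have x0 : 0 < x by lra.
have [u u1 uM] := rotate_to_real (rough_mean k x).
have tail : \sum_(n <- upto x | x / y0 < val (gbelow l n)) 1 <=
    eta * (a * rough_density k * x) / 2.
  apply: le_trans (smooth_tail_count hp C0_gt0 count_upper l (ltW x0) xy0) _.
  rewrite -/D -/M ler_pdivrMr ?ln_gt0//.
  have h0 : 0 <= eta * (a * rough_density k) * x / 2.
    by rewrite ltW// divr_gt0// mulr_gt0// mulr_gt0.
  have := ler_wpM2l h0 tlx.
  have -> : eta * (a * rough_density k) * x / 2 *
    (D * M * 2 / (eta * (a * rough_density k))) = D * x * M.
    by field; rewrite !gt_eqF.
  lra.
have s'0 : 0 <= s + eta by lra.
have bnd y : y0 <= y -> normc (rough_mean l y) <= (s + eta) * rough_count l y.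
  by move=> /Hy0[].
have defsum := deficiency_sum hp z_norm kl (erefl _) (ltW Y0) y01 Yx u1 uM s'0 bnd.
pose A d := u * z ^+ num_prime_factors d * mean_ratio p z l (x / val d).
have dy0 d : val d <= Y -> y0 <= x / val d.
  move=> dY; rewrite ler_pdivlMr ?gval_gt0//; apply: le_trans Yx.
  by rewrite mulrC ler_pM2r.
have Nl d : val d <= Y ->
    a * rough_density l * x * (val d)^-1 / 2 <= rough_count l (x / val d).
  by move=> /dy0/Hy0[_ [+ _]]; lra.
have NAd d : val d <= Y -> 0 < a * rough_density l * x * (val d)^-1 / 2.
  by move=> dY; rewrite !mulr_gt0// invr_gt0 gval_gt0.
have normA d : val d <= Y -> normc (A d) <= s + eta.
  move=> dY; rewrite /A !normcM u1 normc_z// !mul1r.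
  have N0 := lt_le_trans (NAd d dY) (Nl d dY).
  by rewrite normc_real ?invr_ge0 ?(ltW N0)// ler_pdivrMr// bnd// dy0.
exists (fun d => normc (A d - s%:C) < rho); split; last first.
  move=> d d' dY d'Y gd gd' dd' d'd; apply/esym/sep.
  have f1 n : normc (z ^+ n) = 1 by exact: normc_z.
  (* Dividing by z^Omega is avoided by cross multiplication with the two powers. *)
  have lip : normc (mean_ratio p z l (x / val d') - mean_ratio p z l (x / val d)) <=
      2 * rho.
    have [_ [_ n3']] := Hy0 _ (dy0 d' d'Y); apply: n3'.
      by rewrite ler_pM2l// lef_pV2 ?posrE ?gval_gt0.
    rewrite mulrCA ler_pM2l// ler_pdivlMr ?gval_gt0// mulrC ler_pdivrMr ?gval_gt0//.
  rewrite -(ltr_pM2l s0) -{1}(normc_real (ltW s0)) -normcM mulrBr.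
  have -> : s%:C * z ^+ num_prime_factors d' - s%:C * z ^+ num_prime_factors d =
     z ^+ num_prime_factors d * (A d' - s%:C) - z ^+ num_prime_factors d' * (A d - s%:C) -
     u * z ^+ num_prime_factors d * z ^+ num_prime_factors d' *
      (mean_ratio p z l (x / val d') - mean_ratio p z l (x / val d)).
    rewrite /A; move: (z ^+ _) (z ^+ _) (mean_ratio _ _ _ _) (mean_ratio _ _ _ _).
    by move=> f f' h h'; ring.
  apply: le_lt_trans (normc_leB _ _) _.
  apply: (@lt_le_trans _ _ (rho + rho + 2 * rho)); last by rewrite /rho; lra.
  apply: ltr_leD; last by rewrite !normcM u1 !f1 !mul1r.
  apply: le_lt_trans (normc_leB _ _) _.
  by rewrite !normcM !f1 !mul1r; apply: ltrD.
set c := a * rough_density l * x / 2.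
have c0 : 0 < c by rewrite !mulr_gt0.
have bad : c * (rho ^+ 2 / 4) * \sum_(d <- upto Y | gfree k d && ~~ (normc (A d - s%:C) < rho))
    (val d)^-1 <= \sum_(d <- upto Y | gfree k d) ((s + eta) * rough_count l (x / val d) -
      Re (u * z ^+ num_prime_factors d * rough_mean l (x / val d))).
  rewrite mulr_sumr big_mkcondr /= big_seq_cond [leRHS]big_seq_cond.
  apply: ler_sum => d /andP[]; rewrite in_upto// => dY fd.
  have N0 := lt_le_trans (NAd d dY) (Nl d dY).
  have -> : Re (u * z ^+ num_prime_factors d * rough_mean l (x / val d)) =
      Re (A d) * rough_count l (x / val d).
    rewrite -Re_mul_real; congr Re; rewrite /A /mean_ratio -!mulrA.
    by rewrite -rmorphM /= mulVf ?gt_eqF// mulr1.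
  rewrite -mulrBl; have ReA := le_trans (Re_le_normc (A d)) (normA d dY).
  case: ifPn => [nb|_]; last by rewrite mulr_ge0 ?(ltW N0)// subr_ge0.
  have {nb} : rho ^+ 2 / 4 <= s + eta - Re (A d).
    move: nb; rewrite -leNgt => nb.
    have := sqr_normc_sub_real (A d) s.
    have : rho ^+ 2 <= normc (A d - s%:C) ^+ 2 by rewrite ler_pXn2r// nnegrE ?normc_ge0// ltW.
    have : normc (A d) ^+ 2 <= (s + eta) ^+ 2.
      by rewrite ler_pXn2r ?nnegrE ?normc_ge0 ?normA.
    have : eta ^+ 2 <= rho ^+ 2 / 4.
      rewrite (_ : rho ^+ 2 / 4 = (rho / 2) ^+ 2); last by field.
      by rewrite ler_pXn2r// nnegrE ltW// divr_gt0.
    have : s * (s + eta - Re (A d)) <= s + eta - Re (A d).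
      by rewrite ler_piMl// subr_ge0.
    by rewrite !expr2 => i1 i2 i3 i4 i5; rewrite i5 in i4; nra.
  move=> br; rewrite (_ : _ * (val d)^-1 = rho ^+ 2 / 4 * (c / val d)); last by ring.
  apply: ler_pM => //.
  - by rewrite divr_ge0 ?sqr_ge0.
  - by rewrite divr_ge0 ?ltW ?gval_gt0.
  - by apply: le_trans (Nl d dY); rewrite /c mulrAC.
set S := \sum_(d <- _ | _) _ in bad *.
have {}bad : c * (rho ^+ 2 / 4) * S <= 4 * eta * (a * rough_density k * x).
  apply: (le_trans bad); apply: (le_trans defsum).
  have := ler_wpM2l (ltW eta0) Nkx; move: tail lowx.
  have : 0 <= eta * (a * rough_density k * x) by rewrite ltW// mulr_gt0// mulr_gt0.
  lra.
have ax0 : 0 < a * x by rewrite mulr_gt0.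
have r20 : 0 < rho ^+ 2 by rewrite exprn_gt0.
rewrite -(ler_pM2l (_ : 0 < a * x * (rho ^+ 2 * rough_density l))); last first.
  by rewrite mulr_gt0// mulr_gt0.
apply: (@le_trans _ _ (32 * eta * (a * x * rough_density k))).
  by move: bad; rewrite /c; lra.
apply: (@le_trans _ _ (32 * (eps * rho ^+ 2 * c3 / 48) * (a * x * rough_density k))).
  by rewrite ler_pM2r ?ler_pM2l// mulr_gt0.
apply: (@le_trans _ _ (eps * rho ^+ 2 * (a * x * rough_density k) * c3)).
  have : 0 <= eps * rho ^+ 2 * (a * x * rough_density k) * c3.
    by rewrite ltW// !mulr_gt0.
  lra.
rewrite [leRHS](_ : _ = eps * rho ^+ 2 * (a * x * rough_density k) *
  (rough_density l * ln Y)); last by ring.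
by rewrite ler_pM2l// mulr_gt0// mulr_gt0.
Unshelve. all: end_near. Qed.

End Rigidity.


(** * Colouring the logarithmic windows *)
Section Colouring.
Variables (R : realType) (p : nat -> R).
Hypothesis hp : beurling_system p.
Local Notation val := (gint_value p).
Local Notation upto := (upto p).
Variables (z : R[i]) (delta : R).
Hypothesis z_norm : normc z = 1.
Hypothesis delta_gt0 : 0 < delta.

Definition window (d : gint) : nat := Num.truncn (ln (val d) / delta).

Lemma windowP d : (window d)%:R * delta <= ln (val d) < (window d).+1%:R * delta.
Proof.
have h : 0 <= ln (val d) / delta by rewrite divr_ge0 ?ln_ge0 ?gval_ge1 ?ltW.
by have := truncn_itv h; rewrite ler_pdivlMr// ltr_pdivrMr.
Qed.

(** Rounding costs at most one window. *)
Lemma window_mul g m : (window g + window m <= window (gmul g m) <= (window g + window m).+1)%N.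
Proof.
have /andP[g1 g2] := windowP g; have /andP[m1 m2] := windowP m.
have /andP[h1 h2] := windowP (gmul g m).
rewrite gval_mul lnM ?posrE ?gval_gt0// in h1 h2.
apply/andP; split; rewrite -ltnS -(ltr_nat R) -(ltr_pM2r delta_gt0).
  by apply: le_lt_trans h2; rewrite natrD mulrDl lerD.
apply: (le_lt_trans h1); apply: (lt_le_trans (ltrD g2 m2)).
by rewrite -mulrDl -natrD ler_pM2r// ler_nat; lia.
Qed.

Variables (k : nat) (Y : R) (good : pred gint).
Hypothesis rigid : forall d d', val d <= Y -> val d' <= Y -> good d -> good d' ->
  val d <= val d' -> val d' <= expR (3 * delta) * val d ->
  z ^+ num_prime_factors d = z ^+ num_prime_factors d'.

Lemma rigid_window d d' : val d <= Y -> val d' <= Y -> good d -> good d' ->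
  (window d <= (window d').+1)%N -> (window d' <= (window d).+1)%N ->
  z ^+ num_prime_factors d = z ^+ num_prime_factors d'.
Proof.
have main e e' : (window e' <= (window e).+1)%N -> val e' <= expR (3 * delta) * val e.
  move=> we; have /andP[h1 _] := windowP e; have /andP[_ h2] := windowP e'.
  rewrite -[val e']lnK ?posrE ?gval_gt0// -[X in _ * X]lnK ?posrE ?gval_gt0//.
  rewrite -expRD ler_expR; apply: ltW; apply: (lt_le_trans h2).
  apply: (@le_trans _ _ ((window e).+2%:R * delta)); first by rewrite ler_pM2r// ler_nat.
  by rewrite -addn2 natrD mulrDl; move: h1 delta_gt0; lra.
move=> dY d'Y gd gd' w1 w2; have [dd'|/ltW d'd] := leP (val d) (val d').
  by apply: rigid => //; exact: main.
by apply/esym; apply: rigid => //; exact: main.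
Qed.

Definition occupied (i : nat) : bool :=
  has (fun d => good d && (window d == i)) (upto Y).

(** The value of z^Omega at some good integer of the i-th window; by
[colourE] the choice is immaterial.  The default 1 keeps colours nonzero in
windows without good integers. *)
Definition colour (i : nat) : R[i] :=
  head 1 [seq z ^+ num_prime_factors d | d <- upto Y & good d && (window d == i)].

Lemma colour_neq0 i : colour i != 0.
Proof.
rewrite /colour; case: [seq d <- upto Y | _] => [|d s] /=; first exact: oner_neq0.
by apply/eqP => /(congr1 (@normc R)); rewrite normc_z// normc0 => /eqP; rewrite oner_eq0.
Qed.

Lemma occupied_good d : val d <= Y -> good d -> occupied (window d).
Proof. by move=> dY gd; apply/hasP; exists d; rewrite ?in_upto// gd eqxx. Qed.

Lemma colourE d i : val d <= Y -> good d -> occupied i ->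
  (window d <= i.+1)%N -> (i <= (window d).+1)%N ->
  colour i = z ^+ num_prime_factors d.
Proof.
move=> dY gd occ w1 w2; move: occ; rewrite /occupied /colour has_filter.
set s := [seq _ <- _ | _] => s0.
have : head d s \in s by case: s s0 => //= e s _; rewrite mem_head.
have -> : head 1 [seq z ^+ num_prime_factors e | e <- s] =
   z ^+ num_prime_factors (head d s) by case: s s0.
rewrite mem_filter in_upto// => /andP[/andP[ge /eqP we] eY].
by apply: rigid_window; rewrite ?we.
Qed.

Definition bad_weight : R :=
  \sum_(d <- upto Y | gfree k d && ~~ good d) (val d)^-1.

Definition bad_multiples (j : nat) : R :=
  \sum_(m <- upto (Y / p j) | gfree k m && ~~ good (gmul (gprime j) m)) (val m)^-1.

Lemma bad_multiples_ge0 j : 0 <= bad_multiples j.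
Proof. by apply: sumr_ge0 => d _; rewrite invr_ge0 ltW// gval_gt0. Qed.

(** Chebyshev's device: each bad n is counted with weight (sum of ln p over the
primes p dividing n) / n, which is at most (ln n) / n. *)
Lemma sum_bad_multiples l :
  \sum_(j < l | (k <= j)%N) ln (p j) / p j * bad_multiples j <= ln Y * bad_weight.
Proof.
apply: (@le_trans _ _ (\sum_(j < l | (k <= j)%N) \sum_(d <- upto Y | gfree k d && ~~ good d)
   (if (0 < d j)%N then ln (p j) else 0) * (val d)^-1)).
  apply: ler_sum => j kj; rewrite -mulrA.
  have -> : (p j)^-1 * bad_multiples j =
      \sum_(d <- upto Y | gdvd (gprime j) d && (gfree k d && ~~ good d)) (val d)^-1.
    rewrite (big_upto_dvd hp (fun d => gfree k d && ~~ good d)) gval_prime mulr_sumr.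
    apply: eq_big => [m|m _]; first by rewrite gfree_mul gfree_prime kj.
    by rewrite gval_mul gval_prime invfM.
  rewrite mulr_sumr le_eqVlt; apply/orP; left; apply/eqP.
  rewrite big_mkcond [RHS]big_mkcond; apply: eq_bigr => d _.
  by rewrite gprime_dvd; case: (0 < d j)%N; case: ifP; rewrite ?mul0r.
rewrite (exchange_big_dep (fun d => gfree k d && ~~ good d)) //= mulr_sumr.
rewrite big_seq_cond [leRHS]big_seq_cond; apply: ler_sum => d /andP[dY /andP[fd gd]].
rewrite in_upto// in dY; have v0 := gval_gt0 hp d.
rewrite fd gd -mulr_suml ler_pM2r ?invr_gt0//.
apply: (@le_trans _ _ (ln (val d))); last by rewrite ler_ln ?posrE// (lt_le_trans v0).
have [m sm] := gsupp_bound d.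
rewrite (ln_gval hp (gsmoothW (leq_maxl m l) sm)).
rewrite (big_ord_widen_cond (maxn m l) (fun j => (k <= j)%N && true)
  (fun j => if (0 < d j)%N then ln (p j) else 0)) ?leq_maxr//.
rewrite big_mkcond; apply: ler_sum => j _.
have lp := ln_gprime_gt0 hp j.
have h0 : 0 <= (d j)%:R * ln (p j) by rewrite mulr_ge0// ltW.
case: ifP => // _; case: ifP => // dj.
by rewrite ler_peMl ?ler1n// ltW.
Qed.

(** Neighbouring windows can differ in colour only if one of them contains no
good integer. *)
Lemma colour_transitions I :
  (shift_dist colour (I + I) 0 1 <=
   2 * count (predC occupied) (iota 0 (4 * I).+1))%N.
Proof.
rewrite mul2n -addnn.
have s0 := @count_shift (predC occupied) 0 (I + I) (4 * I).+1 ltac:(lia).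
have s1 := @count_shift (predC occupied) 1 (I + I) (4 * I).+1 ltac:(lia).
apply: leq_trans (leq_add s0 s1); rewrite -count_predUI.
apply: leq_trans (leq_addr _ _); apply: sub_count => u /=; rewrite addn0.
apply: contraNT; rewrite negb_or !negbK => /andP[ou ou1].
case/hasP: (ou) => d; rewrite in_upto// => dY /andP[gd /eqP wd].
by apply/eqP; rewrite (colourE dY gd ou) ?(colourE dY gd ou1) ?wd//; lia.
Qed.

Variables (i0 : nat) (cw : R).
Hypothesis cw_gt0 : 0 < cw.
Hypothesis weight : forall i : nat, (i0 <= i)%N -> forall Y,
  expR (i.+1%:R * delta) <= Y ->
  cw <= \sum_(n <- upto Y | gfree k n && (window n == i)) (val n)^-1.

(** Each window has weight at least [cw] from the index i0 on, so a set of
windows all of whose integers satisfy P is small when P has small weight. *)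
Lemma window_count (P : pred gint) (Q : pred nat) (J : nat) (X : R) :
  expR (J%:R * delta) <= X ->
  (forall d, val d <= X -> gfree k d -> Q (window d) -> P d) ->
  (count Q (iota 0 J))%:R <=
  i0%:R + (\sum_(d <- upto X | gfree k d && P d) (val d)^-1) / cw.
Proof.
move=> JX QP.
apply: (@le_trans _ _ (i0%:R + (count (predI Q (leq i0)) (iota 0 J))%:R)).
  rewrite -natrD ler_nat.
  have few : (count (fun i => (i < i0)%N) (iota 0 J) <= i0)%N.
    rewrite -size_filter -[leqRHS](size_iota 0); apply: uniq_leq_size.
      by rewrite filter_uniq// iota_uniq.
    by move=> i; rewrite mem_filter !mem_iota => /andP[].
  apply: leq_trans (leq_add few (leqnn _)); rewrite -count_predUI.
  apply: leq_trans (leq_addr _ _); apply: sub_count => i /= ->.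
  by rewrite ltnNge /= orNb.
rewrite lerD2l ler_pdivlMr// -sum1_count natr_sum mulr_suml.
apply: (@le_trans _ _ (\sum_(i <- iota 0 J | Q i && (i0 <= i)%N)
   \sum_(n <- upto X | gfree k n && P n && (window n == i)) (val n)^-1)).
  rewrite big_seq_cond [leRHS]big_seq_cond; apply: ler_sum => i /andP[].
  rewrite mem_iota add0n /= => iJ /andP[Qi ii0]; rewrite mul1r.
  have iX : expR (i.+1%:R * delta) <= X.
    by apply: le_trans JX; rewrite ler_expR ler_pM2r// ler_nat.
  apply: le_trans (weight ii0 iX) _.
  apply: ler_sum_upto => // [n nX /andP[fn /eqP wn]|n _]; last first.
    by rewrite invr_ge0 ltW// gval_gt0.
  by rewrite fn wn eqxx QP ?wn.
rewrite (exchange_big_dep (fun n => gfree k n && P n)) /=; last by move=> i n _ /andP[].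
apply: ler_sum => n ->; rewrite /= -big_filter.
have v0 : 0 <= (val n)^-1 by rewrite invr_ge0 ltW// gval_gt0.
set s := [seq _ <- _ | _].
have us : uniq s by rewrite filter_uniq// iota_uniq.
have : (size s <= 1)%N.
  apply: (@uniq_leq_size _ s [:: window n]) => // i.
  by rewrite mem_filter inE => /andP[/andP[_ /eqP ->]].
case: s {us} => [|i [|//]] _; first by rewrite big_nil.
by rewrite big_seq1.
Qed.

Lemma vacant_count J : expR (J%:R * delta) <= Y ->
  (count (predC occupied) (iota 0 J))%:R <= i0%:R + bad_weight / cw.
Proof.
move=> JY; apply: window_count => // d dY _; apply: contraNN => gd.
exact: occupied_good.
Qed.

(** Let u be a window that holds some m such that both m and p_j m are good.
Then p_j m lies in the window u + b or the next one, where b is the window of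
p_j, and z^Omega(p_j m) = z z^Omega(m).  Windows u without such an m are rare by
[window_count]. *)
Lemma colour_defect I j : expR (4 * I%:R * delta) <= Y ->
  (window (gprime j) < I)%N ->
  (shift_defect colour (fun w => z * w) (I + I) (window (gprime j)))%:R <=
  i0%:R + (bad_weight + bad_multiples j) / cw +
  (count (predC occupied) (iota 0 (4 * I).+1))%:R.
Proof.
have in_range b' : (b' < I)%N -> (b' + (I + I) <= (4 * I).+1)%N by lia.
move=> IY bI; set b := window _ in bI *.
have pj0 := gprime_gt0 hp j; have pj1 := gprime_gt1 hp j.
have Y0 : 0 < Y by apply: lt_le_trans IY; exact: expR_gt0.
have YpY : Y / p j <= Y by rewrite ler_pdivrMr// ler_peMr// ltW.
have /andP[_] := windowP (gprime j); rewrite gval_prime -/b => lpj.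
have JY : expR ((I + I)%:R * delta) <= Y / p j.
  rewrite ler_pdivlMr//; apply: le_trans IY; rewrite -[X in _ * X]lnK ?posrE//.
  rewrite -expRD ler_expR; apply: (@le_trans _ _ ((I + I)%:R * delta + I%:R * delta)).
    rewrite lerD2l; apply: le_trans (ltW lpj) _.
    by rewrite ler_pM2r// ler_nat.
  rewrite -mulrDl ler_pM2r// -natrD -natrM ler_nat; lia.
pose Q u := all (fun m => (gfree k m && (window m == u)) ==>
  (~~ good m || ~~ good (gmul (gprime j) m))) (upto (Y / p j)).
have cQ := @window_count (fun m => ~~ good m || ~~ good (gmul (gprime j) m))
   Q (I + I) (Y / p j) JY.
have {}cQ : (count Q (iota 0 (I + I)))%:R <= i0%:R + (bad_weight + bad_multiples j) / cw.
  apply: le_trans (cQ _) _.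
    move=> d dY fd /allP/(_ d); rewrite in_upto// => /(_ dY).
    by rewrite fd eqxx.
  rewrite lerD2l ler_pM2r ?invr_gt0//.
  apply: (@le_trans _ _ (\sum_(d <- upto (Y / p j) | gfree k d && ~~ good d) (val d)^-1
      + bad_multiples j)).
    rewrite /bad_multiples !big_mkcondr -big_split /=; apply: ler_sum => d _.
    have v0 : 0 <= (val d)^-1 by rewrite invr_ge0 ltW// gval_gt0.
    by case: (good d); case: (good (gmul _ _)); rewrite /= ?addr0 ?add0r ?lerDl.
  rewrite lerD2r; apply: ler_upto => // d _.
  by rewrite invr_ge0 ltW// gval_gt0.
apply: le_trans (lerD cQ (lexx _)); rewrite -natrD ler_nat.
have sb := @count_shift (predC occupied) b (I + I) (4 * I).+1 (in_range b bI).
apply: leq_trans (leq_add (leqnn _) sb); rewrite -count_predUI.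
apply: leq_trans (leq_addr _ _); apply: sub_count => u /=.
apply: contraNT; rewrite negb_or negbK => /andP[/allPn[m]].
rewrite in_upto// => mY; rewrite negb_imply negb_or !negbK.
move=> /andP[/andP[fm /eqP wm] /andP[gm gpm]] occ.
have pmY : val (gmul (gprime j) m) <= Y.
  by rewrite gval_mul gval_prime mulrC -ler_pdivlMr.
have mY' := le_trans mY YpY.
have /andP[w1 w2] := window_mul (gprime j) m; rewrite -/b wm in w1 w2.
have occu : occupied u by rewrite -wm occupied_good.
have e1 : colour (u + b)%N = z ^+ num_prime_factors (gmul (gprime j) m).
  by apply: colourE => //; rewrite addnC; [exact: leq_trans w2 _|exact: leq_trans w1 _].
have e2 : colour u = z ^+ num_prime_factors m by apply: colourE => //; rewrite wm.
by rewrite e1 e2 num_prime_factors_mul num_prime_factors_prime exprD expr1.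
Qed.

End Colouring.


(** * Windows that contain good primes *)
Section PrimeWindows.
Variables (R : realType) (p : nat -> R).
Hypothesis hp : beurling_system p.
Variables (delta Cw X1 : R).
Hypothesis delta_gt0 : 0 < delta.
Hypothesis prime_windows : forall X, X1 <= X -> forall l (P : pred nat),
    (forall j, (j < l)%N -> P j -> X <= p j <= expR delta * X) ->
    \sum_(j < l | P j) ln (p j) / p j <= Cw.
Local Notation window := (window p delta).

(** The Mertens sum splits into the primes of small index, the primes with many
bad multiples, whose weight is controlled by Markov's inequality, and the rest,
which lies in the windows of B; each of these has weight at most Cw. *)
Lemma many_good_windows (k I : nat) (bad_mult : nat -> R) (t S T0 : R) (B : seq nat) :
  let x1 := expR (I.-1%:R * delta) in
  let l := prime_count p x1 in
  (0 < I)%N -> 0 < t ->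
  (forall j, 0 <= bad_mult j) ->
  \sum_(j < maxn k (prime_count p X1)) ln (p j) / p j <= T0 ->
  \sum_(j < l | (k <= j)%N) ln (p j) / p j * bad_mult j <= t * S ->
  B = [seq b <- iota 0 I | has (fun j => [&& (k <= j)%N, bad_mult j <= t &
          window (gprime j) == b]) (iota 0 l)] ->
  mertens_sum p x1 <= T0 + S + Cw * (size B)%:R.
Proof.
move=> x1 l I0 t0 bm0 hT0 hS hB.
have F0 j : 0 <= ln (p j) / p j by exact: mertens_term_ge0.
rewrite /mertens_sum -/l; set j0 := maxn k _ in hT0.
rewrite (bigID (fun j : 'I_l => (j < j0)%N)) /= -addrA lerD//.
  apply: le_trans hT0.
  rewrite (big_ord_widen_cond (maxn l j0) (fun j => (j < j0)%N)
    (fun j => ln (p j) / p j)) ?leq_maxl//.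
  rewrite (big_ord_widen_cond (maxn l j0) xpredT (fun j => ln (p j) / p j)) ?leq_maxr//.
  rewrite big_mkcond [leRHS]big_mkcond; apply: ler_sum => j _ /=.
  by case: (j < j0)%N => //=; case: ifP.
rewrite (bigID (fun j : 'I_l => t < bad_mult j)) /= lerD//.
  rewrite -(ler_pM2l t0); apply: le_trans hS.
  rewrite mulr_sumr big_mkcond [leRHS]big_mkcond /=; apply: ler_sum => j _.
  case: ifPn => [/andP[]|_]; last by case: ifP => // _; rewrite mulr_ge0.
  rewrite -leqNgt geq_max => /andP[-> _] /ltW tb.
  by rewrite mulrC ler_wpM2l.
apply: (@le_trans _ _ (\sum_(b <- B) \sum_(j < l | [&& (j0 <= j)%N, bad_mult j <= t &
    window (gprime j) == b]) ln (p j) / p j)).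
  rewrite (exchange_big_dep (fun j : 'I_l => (j0 <= j)%N && (bad_mult j <= t))) /=; last first.
    by move=> b j _ /and3P[-> ->].
  rewrite big_mkcond [leRHS]big_mkcond; apply: ler_sum => j _ /=.
  rewrite -!leqNgt -leNgt; case: ifP => // /andP[jj0 jt]; rewrite jj0 jt /=.
  have wB : window (gprime j) \in B.
    rewrite hB mem_filter mem_iota; apply/andP; split.
      apply/hasP; exists (j : nat); first by rewrite mem_iota /= ltn_ord.
      by rewrite jt eqxx (leq_trans (leq_maxl _ _) jj0).
    rewrite /= add0n -(ltr_nat R) -(ltr_pM2r delta_gt0).
    have /andP[h1 _] := windowP hp delta_gt0 (gprime j).
    apply: (le_lt_trans h1); rewrite gval_prime.
    have : p j <= x1 by rewrite -lt_prime_count ?ltn_ord.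
    rewrite -ler_ln ?posrE ?expR_gt0 ?gprime_gt0// expRK => /le_lt_trans; apply.
    by rewrite ltr_pM2r// ltr_nat; lia.
  rewrite -big_filter (perm_big [:: window (gprime j)]) ?big_seq1//.
  apply: uniq_perm => //; first by rewrite filter_uniq// hB filter_uniq// iota_uniq.
  move=> b; rewrite mem_filter inE eq_sym; case: eqP => [->|//]; by rewrite wB.
rewrite mulrC -sum1_size natr_sum mulr_suml; apply: ler_sum => b _; rewrite mul1r.
have X1m : X1 <= Num.max X1 (expR (b%:R * delta)) by rewrite le_max lexx.
apply: (@prime_windows _ X1m l
  (fun j => [&& (j0 <= j)%N, bad_mult j <= t & window (gprime j) == b])).
move=> j jl /and3P[jj0 _ /eqP wj].
have /andP[h1 h2] := windowP hp delta_gt0 (gprime j).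
rewrite gval_prime wj in h1 h2.
have pj0 := gprime_gt0 hp j.
apply/andP; split.
  rewrite ge_max; apply/andP; split; last first.
    by rewrite -[leRHS]lnK ?posrE// ler_expR.
  apply: ltW; rewrite ltNge -lt_prime_count// -leqNgt.
  exact: leq_trans (leq_maxr _ _) jj0.
apply: (@le_trans _ _ (expR delta * expR (b%:R * delta))).
  rewrite -[leLHS]lnK ?posrE// -expRD ler_expR; apply: ltW.
  by move: h2; rewrite -[b.+1%:R]natr1 mulrDl mul1r addrC.
by rewrite ler_pM2l ?expR_gt0// le_max lexx orbT.
Qed.

End PrimeWindows.

(** * Vanishing of the mean values *)
Section Vanishing.
Variables (R : realType) (p : nat -> R) (a : R).
Hypothesis hp : beurling_system p.
Hypothesis hpi : chebyshev_upper p.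
Hypothesis ha : 0 < a.
Hypothesis density : forall e, 0 < e ->
  \forall x \near +oo, `|rough_count p 0 x - a * x| <= e * x.

(** The parameter th measures all the exceptional sets.  It is fixed in terms of
delta, which is given before the tolerance in [locally_constant_residue]; this
order of choices makes the proportion of good shifts independent of th. *)
Lemma mean_vanishes (z : R[i]) (K : nat) : (0 < K)%N -> z ^+ K = 1 -> z != 1 ->
  forall e, 0 < e ->
  \forall x \near +oo, normc (rough_mean p z 0 x) <= e * rough_count p 0 x.
Proof.
have le48S (I : nat) : (0 < I)%N -> ((4 * I).+1 <= 8 * I)%N by lia.
have le48 (I : nat) : (4 * I <= 8 * I)%N by lia.
move=> K0 zK z1; apply: contrapT => hneg.
have z_norm : normc z = 1.
  apply/eqP; rewrite -(@pexpr_eq1 _ _ K) ?normc_ge0//.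
  by rewrite -normcX zK normc1.
have [delta d0 H] := locally_constant_residue hp ha density z_norm hpi K0 zK hneg.
have [Cw Cw0 hCw] := mertens_window hp hpi d0.
have [X1 X11 HX1] := (near_pinftyP _).1 hCw.
have [C0 C0_gt0 count_upper] := integer_count_upper hp ha density.
have [c c0 hc] := mertens_lower hp C0_gt0 count_upper ha density.
have [X2 X21 HX2] := (near_pinftyP _).1 hc.
have [cW cWE cW0] : exists2 cW, cW = a * delta / 4 * expR (- (delta / 2)) & 0 < cW.
  by eexists; [reflexivity|rewrite !mulr_gt0 ?expR_gt0].
(* n exceeds twice the inverse proportion of the good shifts among I windows *)
have [n n8] : exists n : nat, 8 * Cw / (c * delta) < n%:R.
  by exists (Num.truncn (8 * Cw / (c * delta))).+1; exact: truncnS_gt.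
have n1 : 1 <= n%:R :> R.
  rewrite ler1n -(ltr_nat R); apply: le_lt_trans n8.
  by rewrite divr_ge0 ?mulr_ge0 ?ltW.
(* N E <= I is the smallness condition of [almost_period_fixpoint] *)
have [N NE] : exists N : R, N = 5 * n%:R + 1 by eexists.
have N6 : 6 <= N by rewrite NE; lra.
have N0 : 0 < N by lra.
have [th [th0 th1 th2 th3]] : exists th, [/\ 0 < th, th <= 1, th <= c / 128 &
    th <= cW / (256 * delta * N)].
  exists (Num.min 1 (Num.min (c / 128) (cW / (256 * delta * N)))).
  have h1 : 0 < c / 128 by apply: divr_gt0 c0 _; rewrite ltr0n.
  have h2 : 0 < cW / (256 * delta * N).
    apply: divr_gt0 cW0 _; apply: mulr_gt0 N0; apply: mulr_gt0 d0.
    by rewrite ltr0n.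
  rewrite !lt_min ltr01 h1 h2.
  by rewrite !ge_min !lexx !orbT.
have [|k Hk] := H (th ^+ 2); first by rewrite exprn_gt0.
have [i0 hi0] := window_weight hp ha density k d0.
pose T0 := \sum_(j < maxn k (prime_count p X1)) ln (p j) / p j.
have nL : \forall L \near +oo, [/\ 64 * delta * N <= L, T0 / th <= L,
    i0%:R * cW / th <= L & 32 * ln X2 <= L].
  by near=> L; split; near: L; exact: nbhs_pinfty_ge (num_real _).
have [Y Y1 /(_ Y (lexx Y)) [[good [bad rigid]] [L1 L2 L3 L4]]] :=
  (near_pinftyP _).1 (filterI Hk (near_pinfty_ln nL)).
set L := ln Y in bad L1 L2 L3 L4.
have Y0 : 0 < Y by exact: lt_le_trans Y1.
set wk := rough_density p k in bad.
have wk0 : 0 < wk by exact: rough_density_gt0.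
(* Shifts reach windows up to 4 I, which must stay below Y. *)
pose I := Num.truncn (L / (8 * delta)).
have d80 : 0 < 8 * delta by rewrite mulr_gt0.
have dN0 : 0 < delta * N by rewrite mulr_gt0.
have L0 : 0 < L by apply: lt_le_trans L1; rewrite -mulrA mulr_gt0.
have /andP[I1 I2] : I%:R * (8 * delta) <= L < I.+1%:R * (8 * delta).
  have := truncn_itv (ltW (divr_gt0 L0 d80)).
  by rewrite ler_pdivlMr// ltr_pdivrMr.
have I7 : 7 * N <= I%:R.
  have : 8 * N < I.+1%:R.
    rewrite -(ltr_pM2r d80); apply: le_lt_trans I2; lra.
  by rewrite -natr1; lra.
have Igt0 : (0 < I)%N by rewrite -(ltr_nat R); lra.
have thL : th * L <= c * delta * (I.+1%:R / 16).
  apply: (@le_trans _ _ (c / 128 * (I.+1%:R * (8 * delta)))); last by lra.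
  by apply: ler_pM => //; apply: ltW.
have thL' : 8 * th * L / cW <= I.+1%:R / (4 * N).
  rewrite ler_pdivrMr//.
  apply: (@le_trans _ _ (8 * (cW / (256 * delta * N)) * (I.+1%:R * (8 * delta)))).
    rewrite -[8 * th * L]mulrA -[leRHS]mulrA ler_pM2l//.
    by apply: ler_pM => //; apply: ltW.
  rewrite le_eqVlt; apply/orP; left; apply/eqP; field.
  by rewrite !gt_eqF.
have T0L : T0 <= th * L by rewrite mulrC -ler_pdivrMr.
have i0L : i0%:R <= th * L / cW by rewrite ler_pdivlMr// [th * L]mulrC -ler_pdivrMr.
have cw0 : 0 < cW * wk by rewrite mulr_gt0.
have weight : forall i : nat, (i0 <= i)%N -> forall Y', expR (i.+1%:R * delta) <= Y' ->
  cW * wk <= \sum_(n <- upto p Y' | gfree k n && (window p delta n == i))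
    (gint_value p n)^-1.
  by move=> i ii0 Y' iY'; have := hi0 i ii0 Y' iY'; rewrite -cWE.
have YJ (J : nat) : (J <= 8 * I)%N -> expR (J%:R * delta) <= Y.
  move=> JI; rewrite -[leRHS]lnK ?posrE// ler_expR -/L; apply: le_trans I1.
  by rewrite mulrA ler_pM2r// -natrM ler_nat mulnC.
have badE : bad_weight p k Y good / (cW * wk) <= th * L / cW.
  rewrite ler_pdivrMr// (_ : _ * (cW * wk) = th * (wk * L)); last first.
    by field; rewrite gt_eqF.
  apply: (le_trans bad); rewrite -/L ler_pM2r ?mulr_gt0//.
  by rewrite expr2 ler_piMl// ltW.
pose V := count (predC (occupied p delta Y good)) (iota 0 (4 * I).+1).
have VE : V%:R <= 2 * (th * L / cW).
  have JY : expR ((4 * I).+1%:R * delta) <= Y by exact: YJ (le48S I Igt0).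
  have := vacant_count hp d0 good cw0 weight JY; rewrite -/V.
  by move: badE i0L; lra.
pose t := th * (wk * L).
have t0 : 0 < t by rewrite !mulr_gt0.
pose x1 := expR (I.-1%:R * delta).
pose B := [seq b <- iota 0 I | has (fun j => [&& (k <= j)%N,
   bad_multiples p k Y good j <= t & window p delta (gprime j) == b])
   (iota 0 (prime_count p x1))].
have hB : mertens_sum p x1 <= T0 + th * L + Cw * (size B)%:R.
  apply: (@many_good_windows _ _ hp delta Cw X1 d0 HX1 k I
    (bad_multiples p k Y good) t (th * L) T0 B) => //.
    by move=> j; exact: bad_multiples_ge0.
  have := sum_bad_multiples hp k Y good (prime_count p x1).
  move=> /le_trans; apply; rewrite -/L.
  have -> : t * (th * L) = L * (th ^+ 2 * (wk * L)) by rewrite /t; ring.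
  by rewrite ler_pM2l.
have I1E : I.-1%:R = I%:R - 1 :> R by rewrite -subn1 natrB.
have I2E : I.+1%:R = I%:R + 1 :> R by rewrite -natr1.
have sizeB : (I + I < n * size B)%N.
  have x1X2 : X2 <= x1.
    rewrite -[leLHS]lnK ?posrE; last by lra.
    rewrite ler_expR; have : 32 * ln X2 <= (I%:R + 1) * (8 * delta).
      by rewrite -I2E; apply: (le_trans L4); apply: ltW.
    have : 0 <= delta * (I%:R - 42) by rewrite mulr_ge0 ?(ltW d0)//; lra.
    by rewrite I1E; lra.
  have := le_trans (HX2 _ x1X2) hB; rewrite expRK I1E => h.
  have cd0 : 0 < c * delta by rewrite mulr_gt0.
  have h1 : c * delta * (I%:R / 2) <= Cw * (size B)%:R.
    have : 0 <= c * delta * (I%:R - 42) by rewrite mulr_ge0 ?(ltW cd0)//; lra.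
    by move: thL h T0L; rewrite I2E; lra.
  rewrite -(ltr_nat R) natrD natrM.
  apply: (@lt_le_trans _ _ (8 * Cw / (c * delta) * (size B)%:R)).
    rewrite mulrAC ltr_pdivlMr//.
    have : 0 < c * delta * I%:R by rewrite mulr_gt0// ltr0n.
    by move: h1; lra.
  by rewrite ler_wpM2r// ltW.
pose E := (Num.truncn (8 * th * L / cW)).+1.
have q0 : 0 <= 8 * th * L / cW by rewrite divr_ge0 ?ltW// !mulr_gt0.
have leE m : m%:R <= 8 * th * L / cW -> (m <= E)%N.
  by move=> mq; apply: leqW; rewrite truncn_ge_nat.
have z_inj : injective (fun w => z * w).
  apply: mulfI; apply/eqP => z0.
  by move: z_norm; rewrite z0 normc0 => /eqP; rewrite eq_sym oner_eq0.
have EN : E%:R * N <= I%:R.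
  have E1 : E%:R <= I.+1%:R / (4 * N) + 1.
    rewrite -[leLHS]natr1 lerD2r; apply: le_trans thL'.
    by have /andP[] := truncn_itv q0.
  apply: le_trans (ler_wpM2r (ltW N0) E1) _.
  rewrite (_ : (I.+1%:R / (4 * N) + 1) * N = I.+1%:R / 4 + N); last first.
    by field; rewrite gt_eqF.
  by rewrite I2E; lra.
have [|||||||u fix_u] := @almost_period_fixpoint R[i]
    (colour p z delta Y good) (fun w => z * w) z_inj I E n B.
- by [].
- by rewrite filter_uniq// iota_uniq.
- by move=> b; rewrite mem_filter mem_iota => /andP[].
- apply: leE; apply: (@le_trans _ _ (2 * V)%:R).
    by rewrite ler_nat; exact: colour_transitions.
  by rewrite natrM; move: VE q0; lra.
- move=> b; rewrite mem_filter => /andP[/hasP[j _ /and3P[kj jt /eqP wj]]].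
  rewrite mem_iota add0n => /= bI; apply: leE.
  have YI : expR (4 * I%:R * delta) <= Y by rewrite -natrM; exact: YJ (le48 I).
  have bI' : (window p delta (gprime j) < I)%N by rewrite wj.
  have := colour_defect hp d0 rigid cw0 weight YI bI'.
  rewrite wj => /le_trans; apply; rewrite -/V mulrDl.
  have mE : bad_multiples p k Y good j / (cW * wk) <= th * L / cW.
    rewrite ler_pdivrMr//; apply: (le_trans jt); rewrite /t le_eqVlt.
    by apply/orP; left; apply/eqP; field; rewrite gt_eqF.
  by move: VE i0L badE mE; lra.
- exact: sizeB.
- rewrite -(ler_nat R) natrD !natrM; move: EN; rewrite NE.
  by rewrite (_ : E%:R * _ = 5 * E%:R * n%:R + E%:R)//; ring.
have := colour_neq0 p delta z_norm Y good u.
move: fix_u => /eqP; rewrite -[X in _ == X]mul1r -subr_eq0 -mulrBl mulf_eq0 subr_eq0.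
by rewrite (negbTE z1) /= => /eqP -> ; rewrite eqxx.
Unshelve. all: end_near. Qed.

End Vanishing.


(** * From roots of unity to residue classes *)
Lemma primitive_root_exists (F : numClosedFieldType) (n : nat) : (0 < n)%N ->
  exists z : F, n.-primitive_root z.
Proof.
move=> n_gt0; have [r Dp] := closed_field_poly_normal ('X^n - 1 : {poly F}).
rewrite (monicP _) ?monicXnsubC// scale1r in Dp.
have rn1 : all n.-unity_root r by apply/allP => z; rewrite -root_prod_XsubC -Dp.
have sz_r : (n < (size r).+1)%N.
  by rewrite -(size_prod_XsubC r id) -Dp size_XnsubC.
have [|z _ hz] := hasP (has_prim_root n_gt0 rn1 _ sz_r); last by exists z.
by rewrite -separable_prod_XsubC -Dp separable_Xn_sub_1// pnatr_eq0 -lt0n.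
Qed.

Lemma sum_root_powers (F : fieldType) (K t : nat) (w : F) : K.-primitive_root w ->
  \sum_(m < K) (w ^+ t) ^+ m = (if (K %| t)%N then K%:R else 0).
Proof.
move=> pw; rewrite (prim_order_dvd pw); case: eqP => [->|/eqP wt1].
  by under eq_bigr do rewrite expr1n; rewrite sumr_const card_ord.
have /eqP := subrX1 (w ^+ t) K.
rewrite exprAC (prim_expr_order pw) expr1n subrr eq_sym mulf_eq0 subr_eq0.
by rewrite (negbTE wt1) => /eqP.
Qed.

Section ResidueClasses.
Variables (R : realType) (p : nat -> R).
Hypothesis hp : beurling_system p.
Local Notation upto := (upto p).

Lemma integer_count_rough x : (integer_count p x)%:R = rough_count p 0 x.
Proof.
by rewrite rough_countE /integer_count -sum1_size natr_sum.
Qed.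

Lemma residue_count_sum K c x : (residue_count p K c x)%:R =
  \sum_(n <- upto x | num_prime_factors n == c %[mod K]) (1 : R).
Proof.
transitivity ((size [seq n <- upto x | num_prime_factors n == c %[mod K]])%:R : R);
  last by rewrite -sum1_size natr_sum big_filter.
congr _%:R.
apply: perm_size; apply: uniq_perm; rewrite ?fset_uniq ?filter_uniq ?fset_uniq// => n.
rewrite mem_filter in_upto// in_fset_set; last first.
  by apply: sub_finite_set (finite_gints_le x hp) => m [].
apply/idP/andP => [/set_mem[h1 /eqP h2]//|[/eqP h1 h2]]; exact/mem_set.
Qed.

(** The exponent K - c stands for - c, to remain within natural numbers. *)
Lemma residue_count_mean K c x (w : R[i]) : K.-primitive_root w -> (c < K)%N ->
  (K%:R * (residue_count p K c x)%:R)%:C =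
  \sum_(m < K) w ^+ (m * (K - c)) * rough_mean p (w ^+ m) 0 x.
Proof.
move=> pw cK; rewrite residue_count_sum rmorphM rmorph_sum /= mulr_sumr.
rewrite big_mkcond /=.
transitivity (\sum_(n <- upto x) \sum_(m < K) (w ^+ (num_prime_factors n + (K - c))) ^+ m).
  apply: eq_bigr => n _; rewrite (sum_root_powers _ pw) rmorph_nat rmorph1 mulr1.
  have -> : (num_prime_factors n == c %[mod K]) =
      (K %| num_prime_factors n + (K - c))%N.
    rewrite -(eqn_modDr (K - c)) subnKC ?(ltnW cK)// modnn.
    by [].
  by case: ifP; rewrite ?mulr1 ?mulr0.
rewrite exchange_big /=; apply: eq_bigr => m _; rewrite /rough_mean mulr_sumr.
apply: eq_bigr => n _; rewrite exprD exprMn mulrC -!exprM; congr (_ * w ^+ _).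
  by rewrite mulnC.
by rewrite mulnC.
Qed.

End ResidueClasses.

Theorem theorem1p1 (R : realType) (p : nat -> R) (a : R)
    (hp : beurling_system p) (hpi : chebyshev_upper p) (ha : 0 < a)
    (hN : (fun x : R => (integer_count p x)%:R : R) ~_(+oo) (fun x : R => a * x))
    (K c : nat) (hK : (2 <= K)%N) (hc : (c < K)%N) :
  (fun x : R => (residue_count p K c x)%:R : R) ~_(+oo)
    (fun x : R => a * x / K%:R).
Proof.
have K_gt0 : (0 < K)%N by exact: ltnW.
have KR : 0 < K%:R :> R by rewrite ltr0n.
have x_gt0 : \forall x \near +oo, (0 : R) < x by exact: nbhs_pinfty_gt (num_real _).
have density e : 0 < e -> \forall x \near +oo, `|rough_count p 0 x - a * x| <= e * x.
  move=> e0; have ea : 0 < e / a by rewrite divr_gt0.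
  have /eqaddoP/(_ _ ea) h := hN; apply: filterS2 h x_gt0 => x + x0 /=.
  rewrite !fctE integer_count_rough normrM (gtr0_norm ha) (gtr0_norm x0).
  by rewrite mulrA divfK ?gt_eqF.
have [w pw] := @primitive_root_exists R[i] K K_gt0.
apply/eqaddoP => e e0.
have e1 : 0 < e / 4 by rewrite divr_gt0.
have ea : 0 < e * a / 2 by rewrite divr_gt0// mulr_gt0.
have means : \forall x \near +oo, forall m : 'I_K, (0 < m)%N ->
    normc (rough_mean p (w ^+ m) 0 x) <= e / 4 / K%:R * rough_count p 0 x.
  apply: filter_forall => m; case: (posnP m) => [->|m0]; first exact: nearW.
  have wm1 : w ^+ m != 1.
    by rewrite -(prim_order_dvd pw) gtnNdvd.
  have wmK : (w ^+ m) ^+ K = 1 by rewrite exprAC (prim_expr_order pw) expr1n.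
  have eK : 0 < e / 4 / K%:R by rewrite divr_gt0.
  apply: filterS (mean_vanishes hp hpi ha density K_gt0 wmK wm1 eK) => x h _.
  exact: h.
have dens1 := density _ ea.
have dens2 := density _ ha.
near=> x.
have x0 : 0 < x by near: x; exact: x_gt0.
have /= d1 : `|rough_count p 0 x - a * x| <= e * a / 2 * x by near: x.
have /= d2 : `|rough_count p 0 x - a * x| <= a * x by near: x.
have /= ms : forall m : 'I_K, (0 < m)%N ->
  normc (rough_mean p (w ^+ m) 0 x) <= e / 4 / K%:R * rough_count p 0 x by near: x.
set S : R := (residue_count p K c x)%:R; set N := rough_count p 0 x in d1 d2 ms.
have w1 : normc w = 1.
  apply/eqP; rewrite -(@pexpr_eq1 _ _ K) ?normc_ge0//.
  by rewrite -normcX (prim_expr_order pw) normc1.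
have KSN : `|K%:R * S - N| <= e / 4 * N.
  have := residue_count_mean hp x pw hc; rewrite -/S.
  rewrite (bigD1 (Ordinal K_gt0)) //= mul0n expr0 mul1r.
  have -> : rough_mean p 1 0 x = N%:C.
    rewrite /rough_mean /N rough_countE rmorph_sum /=.
    by apply: eq_bigr => n _; rewrite expr1n rmorph1.
  move=> E.
  have {}E : (K%:R * S - N)%:C = \sum_(m < K | m != Ordinal K_gt0)
      w ^+ (m * (K - c)) * rough_mean p (w ^+ m) 0 x.
    have -> : (K%:R * S - N)%:C = (K%:R * S)%:C - N%:C by exact: rmorphB.
    by rewrite E addrAC subrr add0r.
  have -> : `|K%:R * S - N| = normc (K%:R * S - N)%:C.
    by rewrite /= expr0n addr0 sqrtr_sqr.
  rewrite E; have h := normc_sum (index_enum 'I_K) (fun m => m != Ordinal K_gt0)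
    (fun m : 'I_K => w ^+ (m * (K - c)) * rough_mean p (w ^+ m) 0 x).
  apply: (le_trans h).
  have N0 : 0 <= N by exact: rough_count_ge0.
  have eN0 : 0 <= e / 4 / K%:R * N by rewrite mulr_ge0// divr_ge0// ltW.
  apply: (@le_trans _ _ (\sum_(m < K) (e / 4 / K%:R * N))).
    rewrite big_mkcond; apply: ler_sum => m _; case: ifP => // m0.
    rewrite normcM normcX w1 expr1n mul1r ms// lt0n.
    by move: m0; apply: contraNneq => m00; apply/eqP/val_inj.
  rewrite sumr_const card_ord -mulr_natl le_eqVlt; apply/orP; left; apply/eqP.
  by field; rewrite gt_eqF.
rewrite !fctE -/S /=.
have ax0 : 0 < a * x by rewrite mulr_gt0.
rewrite [X in _ <= _ * X]ger0_norm; last by rewrite divr_ge0// ltW.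
rewrite -(ler_pM2l KR) -[X in X * `|_|](gtr0_norm KR) -normrM.
rewrite (_ : K%:R * (S - _) = (K%:R * S - N) + (N - a * x)); last first.
  by field; rewrite gt_eqF.
rewrite (_ : K%:R * (e * _) = e * (a * x)); last by field; rewrite gt_eqF.
apply: le_trans (ler_normD _ _) _; apply: le_trans (lerD KSN d1) _.
have N2 : N <= 2 * (a * x) by move: d2; rewrite ler_norml => /andP[_]; lra.
by have := ler_wpM2l (ltW e1) N2; lra.
Unshelve. all: end_near. Qed.
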